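(* Let $n\ge2$, $x_0>0$, $K\ge0$, $0\le K_2\le K$, and consider the contest with regret over failure to stop at the best time described in the context, in which $M^i=\sup_{0\le t\le H^i_0}X^i_t$. For $x\ge0$ let $$F(x)=\min\Big\{\Big(\frac{x}{nx_0}\Big)^{1/(n-1)},\,1\Big\}.$$ Then there exists a symmetric, atom-free Nash equilibrium in which, for every player $i$, $X^i_{\tau^i}$ has law $F$: if every player $j\ne i$ uses a stopping time $\tau^j$ with $X^j_{\tau^j}\sim F$, then any admissible stopping time $\tau^i$ with $X^i_{\tau^i}\sim F$ maximizes player $i$'s expected payoff over all her admissible stopping times.
   Context: There are $n$ players $i\in\{1,\dots,n\}$. Player $i$ privately observes a Brownian motion $X^i$ with $X^i_0=x_0>0$, absorbed at $0$; the processes are independent. Let $\mathcal{F}^i_t=\sigma(X^i_s:s<t)$ and $H^i_0=\inf\{t\ge0:X^i_t=0\}$. An admissible strategy of player $i$ is an $(\mathcal{F}^i_t)$-stopping time $\tau^i\le H^i_0$. With $M^i=\sup_{0\le t\le H^i_0}X^i_t$, player $i$'s payoff is $$\frac1k\mathbf 1_{\{X^i_{\tau^i}=\max_{j}X^j_{\tau^j}\}}-K\,\mathbf 1_{\{X^i_{\tau^i}<\max_{j\ne i}X^j_{\tau^j}<M^i\}}-K_2\,\mathbf 1_{\{X^i_{\tau^i}<\max_{j\ne i}X^j_{\tau^j}=M^i\}},$$ where $k=|\{l:X^l_{\tau^l}=\max_jX^j_{\tau^j}\}|$; each player maximizes her expected payoff. A Nash equilibrium is symmetric if all players' stopped values have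 the same law and atom-free if that law has no atoms. *)

(* Defs.v *)
From HB Require Import structures.
From mathcomp Require Import all_boot all_order all_algebra.
From mathcomp Require Import all_classical all_reals all_analysis.
Set Implicit Arguments. Unset Strict Implicit. Unset Printing Implicit Defensive.
Import Order.TTheory GRing.Theory Num.Theory Num.Def.
Import numFieldTopology.Exports.
Local Open Scope classical_set_scope.
Local Open Scope ring_scope.

Section Contest.
Context {R : realType} {d : measure_display} {Omega : measurableType d}.
Variable P : probability Omega R.

Definition standard_BM (W : R -> Omega -> R) : Prop :=
  [/\ (forall t, measurable_fun setT (W t)),
      (forall w, W 0 w = 0),
      (forall w, {within [set t : R | 0 <= t], continuous (fun t => W t w)}) &
      (forall (k : nat) (t : 'I_k.+1 -> R) (B : 'I_k -> set R),
         0 <= t ord0 ->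
         (forall j : 'I_k, t (widen_ord (leqnSn k) j) < t (lift ord0 j)) ->
         (forall j, measurable (B j)) ->
         P (\bigcap_(j in [set: 'I_k])
              [set w | W (t (lift ord0 j)) w - W (t (widen_ord (leqnSn k) j)) w
                       \in B j])
         = (\prod_(j < k)
              normal_prob 0 (Num.sqrt (t (lift ord0 j) - t (widen_ord (leqnSn k) j)))
                (B j))%E)].

Definition hit0 (Y : R -> Omega -> R) (w : Omega) : \bar R :=
  ereal_inf [set t%:E | t in [set t : R | 0 <= t /\ Y t w = 0]].

Definition absorbed_BM (x0 : R) (X : R -> Omega -> R) : Prop :=
  exists W, standard_BM W /\
    forall t w, 0 <= t ->
      X t w = if (t%:E <= hit0 (fun s w => (x0 + W s w)%R) w)%E
              then x0 + W t w else 0.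

Definition mutually_independent (n : nat) (G : 'I_n -> set_system Omega) :=
  forall A : 'I_n -> set Omega, (forall i, G i (A i)) ->
    P (\bigcap_(i in [set: 'I_n]) A i) = (\prod_(i < n) P (A i))%E.

Definition gen_by (X : R -> Omega -> R) (S : set R) : set_system Omega :=
  <<s [set A | exists s B, S s /\ measurable B /\ A = X s @^-1` B] >>.

Definition nat_filtration (X : R -> Omega -> R) (t : R) : set_system Omega :=
  gen_by X [set s | 0 <= s < t].

Definition admissible (X : R -> Omega -> R) (tau : Omega -> \bar R) : Prop :=
  (forall w, (0 <= tau w)%E /\ (tau w <= hit0 X w)%E) /\
  (forall t, 0 <= t -> nat_filtration X t [set w | (tau w <= t%:E)%E]).

Definition stopped (X : R -> Omega -> R) (tau : Omega -> \bar R) (w : Omega) : R :=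
  X (fine (tau w)) w.

Definition run_max (X : R -> Omega -> R) (w : Omega) : \bar R :=
  ereal_sup [set (X t w)%:E | t in [set t : R | 0 <= t /\ (t%:E <= hit0 X w)%E]].

Definition payoff (n : nat) (K K2 : R) (i : 'I_n) (Y : 'I_n -> R) (M : \bar R) : R :=
  let mx := (\big[Order.max/-oo]_(j < n) (Y j)%:E)%E in
  let mo := (\big[Order.max/-oo]_(j < n | j != i) (Y j)%:E)%E in
  let k := #|[set l : 'I_n | (Y l)%:E == mx]| in
  (((Y i)%:E == mx)%:R / k%:R)
  - K * ((((Y i)%:E < mo) && (mo < M))%E)%:R
  - K2 * ((((Y i)%:E < mo) && (mo == M))%E)%:R.

Definition exp_payoff (n : nat) (K K2 : R) (X : 'I_n -> R -> Omega -> R)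
  (tau : 'I_n -> Omega -> \bar R) (i : 'I_n) : \bar R :=
  (\int[P]_w (payoff K K2 i (fun j => stopped (X j) (tau j) w) (run_max (X i) w))%:E)%E.

Definition has_law (X : R -> Omega -> R) (tau : Omega -> \bar R) (F : R -> R) :=
  forall x : R, P [set w | stopped X tau w <= x] = (F x)%:E.

End Contest.

Definition Flaw {R : realType} (n : nat) (x0 : R) (x : R) : R :=
  if x < 0 then 0
  else Num.min (powR (x / (n%:R * x0)) (n.-1%:R)^-1) 1.

Definition upd {n : nat} {T : Type} (f : 'I_n -> T) (i : 'I_n) (a : T) : 'I_n -> T :=
  fun j => if j == i then a else f j.

(* Main.v *)
Require Import Defs.
From HB Require Import structures.
From mathcomp Require Import all_boot all_order all_algebra.
From mathcomp Require Import all_classical all_reals all_analysis.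
From mathcomp Require Import measurable_realfun ring lra.
Set Implicit Arguments. Unset Strict Implicit. Unset Printing Implicit Defensive.
Import Order.TTheory GRing.Theory Num.Theory.
Import numFieldNormedType.Exports.
Local Open Scope classical_set_scope.
Local Open Scope ring_scope.

(** Existence: the law [F] is embedded by the Azema-Yor time, the first time at
    which the barycentre function of [F], evaluated at [X], falls to the running
    maximum of [X]. Optional stopping at this time and at its minimum with a
    hitting time gives the conditional means of [F (X_tau)] above each level,
    and these means force [F (X_tau)] to be uniform on [[0, 1]]. Optional
    stopping itself is obtained from [E (a + W_sigma)^2 <= a^2 + v] for all [a],
    which follows by discretising [sigma].

    Optimality: the maximum [V] of the other players' values is independent of
    [X^i] and uniform on [[0, n x0]]. Player [i]'s payoff is at most
    [(1 + K) 1{V <= Y} - K 1{V < M}], with almost sure equality when she uses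
    [tau^i], and the second term does not depend on her strategy. Since
    [P (V <= Y) <= E Y / (n x0) <= 1 / n] by the supermartingale property, and
    since by symmetry [tau^i] wins with probability at least [1 / n], no
    deviation is profitable. *)

(** Fatou's lemma leaves only an inequality for squares of discretised stopped values. Letting the
    shift [a] vary repairs this: the terms [a ^+ 2] cancel, and a linear function of [a] bounded on
    the whole line is constant, so the mean is exact without conditional expectations or uniform
    integrability.

    Put [c = n * x0] and [S = c * U ^+ (n - 1)]. For uniform [U], the mean of [S] given [U >= u] is
    [c * (1 - u ^+ n) / (n * (1 - u)) = x0 * (1 + u + ... + u ^+ (n - 1))], so the barycentre is a
    polynomial in [F]. Conversely, that mean identity, differentiated, gives [g' = - g / (1 - u)]
    for the survival function [g] of [U]; nothing is known about the smoothness of [g], so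
    increments replace derivatives.

    The exponent [1 / (n - 1)] makes the best of [n - 1] rivals uniform, hence the chance of not
    being beaten linear in the stopped value up to [c]. The constant [c] turns the mean [x0] into
    [1 / n], the share that symmetry guarantees.

    A stopping time may be infinite, where [stopped] reads the path at time [0] ([fine +oo = 0]);
    almost sure absorption makes this harmless. *)

Section MeasureTools.
Context {R : realType}.

Lemma ge0_integral_mrestr d (T : measurableType d) (P : {measure set T -> \bar R})
    (A : set T) (mA : measurable A) (f : T -> \bar R) :
  measurable_fun setT f -> (forall x, 0 <= f x)%E ->
  (\int[mrestr P mA]_x f x = \int[P]_(x in A) f x)%E.
Proof.
move=> mf f0; rewrite -(setUv A) ge0_integral_setU//=; last 3 first.
- exact: measurableC.
- exact: measurable_funTS.
- by apply/disj_setPCl.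
rewrite [X in (_ + X)%E](_ : _ = 0%E) ?adde0; last first.
  rewrite (eq_measure_integral mzero) ?integral_measure_zero// => B mB BA.
  rewrite /= /mrestr /mzero /=.
  have -> : B `&` A = set0 by apply/disjoints_subset.
  by rewrite measure0.
apply: eq_measure_integral => B mB BA.
by rewrite /= /mrestr setIidl.
Qed.

(** A Tonelli formula in place of conditional expectation: under [P] restricted to [A], the joint
    law of [(U, V)] agrees with a product on rectangles, hence everywhere. The event [A] carries the
    past of a path; [nu] is the law of what is independent of it. *)
Lemma integral_indep d1 d2 d3 (T : measurableType d1) (T1 : measurableType d2)
    (T2 : measurableType d3) (P : probability T R) (A : set T)
    (U : T -> T1) (V : T -> T2) (nu : probability T2 R)
    (f : (T1 * T2)%type -> \bar R) :
  measurable A -> measurable_fun setT U -> measurable_fun setT V ->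
  (forall C E, measurable C -> measurable E ->
     P (A `&` U @^-1` C `&` V @^-1` E) = (P (A `&` U @^-1` C) * nu E)%E) ->
  measurable_fun [set: T1 * T2] f -> (forall x, 0 <= f x)%E ->
  (\int[P]_(w in A) f (U w, V w) = \int[P]_(w in A) \int[nu]_v f (U w, v))%E.
Proof.
move=> mA mU mV ind mf f0.
have mUV : measurable_fun [set: T] (fun w => (U w, V w)).
  exact: measurable_fun_pair.
pose m1f : {measure set T1 -> \bar R} := pushforward (mrestr P mA) U.
pose m1 := m1f mU.
have m1oo : (m1 setT < +oo)%E.
  rewrite -ge0_fin_numE// /m1 /= /pushforward /= /mrestr fin_num_measure//.
  by rewrite preimage_setT setTI.
pose m1' : {finite_measure set T1 -> \bar R} := mfrestr measurableT m1oo.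
pose m2f : {measure set (T1 * T2)%type -> \bar R} :=
  pushforward (mrestr P mA) (fun w => (U w, V w)).
pose m2 := m2f mUV.
have mF : measurable_fun setT (fun u => \int[nu]_v f (u, v))%E.
  exact: measurable_fun_fubini_tonelli_F.
have m12 : forall X, measurable X -> (m1' \x nu)%E X = m2 X.
  apply: product_measure_unique => C E mC mE.
  rewrite /m2 /m1' /m1 /= /mfrestr /pushforward /= /mrestr /=.
  rewrite setIT setIC [in RHS]setIC -ind//; congr (P _).
  by rewrite -setIA; congr (_ `&` _).
transitivity (\int[m2]_z f z)%E.
  rewrite /m2 ge0_integral_pushforward//.
  rewrite preimage_setT ge0_integral_mrestr//; first exact: measurableT_comp.
  by move=> x /=; exact: f0.
transitivity (\int[(m1' \x nu)]_z f z)%E.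
  by apply: eq_measure_integral => X mX _; exact/esym/m12.
have F0 u : (0 <= \int[nu]_v f (u, v))%E by apply: integral_ge0 => v _.
rewrite fubini_tonelli1//= /m1' /mfrestr ge0_integral_mrestr// /m1 ge0_integral_pushforward//.
  rewrite preimage_setT ge0_integral_mrestr//; first exact: measurableT_comp.
  by move=> x /=; exact: F0.
by move=> x _; exact: F0.
Qed.

Lemma integral_prob_cst d (T : measurableType d) (P : probability T R) (c : R) :
  (\int[P]_x c%:E = c%:E)%E.
Proof.
rewrite -[LHS]/(\int[P]_x (cst c%:E x))%E integral_cst//.
by rewrite /= probability_setT mule1.
Qed.

(** Rays form an intersection-stable generator of the Borel sets. Through this, players whose
    stopped values have the same distribution function give the same integrals. *)
Lemma measure_unique_rays (m1 m2 : {finite_measure set R -> \bar R}) :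
  (forall x : R, m1 `]-oo, x]%classic = m2 `]-oo, x]%classic) ->
  forall A, measurable A -> m1 A = m2 A.
Proof.
move=> m12; pose G := [set A : set R | exists x, A = `]-oo, x]%classic].
apply: (measure_unique G (fun n => `]-oo, n%:R]%classic)).
- apply/seteqP; split => A; last first.
    apply: smallest_sub; first exact: sigma_algebra_measurable.
    by move=> _ [x ->].
  rewrite (_ : measurable A = (@measurable _ (g_sigma_algebraType (@ocitv R)) A))//.
  rewrite RGenOInfty.measurableE.
  apply: smallest_sub => [|B [x ->]]; first exact: smallest_sigma_algebra.
  rewrite -setCitvl -setTD; apply: sigma_algebraCD.
  by apply: sub_sigma_algebra; exists x.
- move=> _ _ [x ->] [y ->]; exists (Num.min x y).
  by apply/seteqP; split => z /=; rewrite !in_itv/= le_min => /andP.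
- by move=> i; exists i%:R.
- apply/seteqP; split => // x _; exists (Num.truncn `|x|).+1 => //=.
  rewrite in_itv/= (le_trans (ler_norm x))//.
  by rewrite ltW// truncnS_gt.
- by move=> _ [x ->]; exact: m12.
- by move=> k; rewrite -ge0_fin_numE ?measure_ge0 ?fin_num_measure.
Qed.

Import HBNNSimple.

(** The identity holds on indicators by the hypothesis on [nu], passes to simple functions by
    linearity and to [f] by monotone convergence. *)
Lemma integral_density d (T : measurableType d) (mu : {measure set T -> \bar R})
    (nu : {measure set T -> \bar R}) (g : T -> R) (f : T -> \bar R) :
  measurable_fun setT g -> (forall x, 0 <= g x) ->
  (forall A, measurable A -> nu A = \int[mu]_(x in A) (g x)%:E)%E ->
  measurable_fun setT f -> (forall x, 0 <= f x)%E ->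
  (\int[nu]_x f x = \int[mu]_x (f x * (g x)%:E))%E.
Proof.
move=> mg g0 nuE mf f0.
have mg' : measurable_fun setT (EFin \o g) by exact/measurable_EFinP.
pose f_ := nnsfun_approx measurableT mf.
have indic_case (r : R) (E : set T) : (0 <= r)%R -> measurable E ->
    (\int[nu]_x (r * \1_E x)%:E = \int[mu]_x ((r * \1_E x)%:E * (g x)%:E))%E.
  move=> r0 mE; under eq_integral do rewrite EFinM.
  rewrite ge0_integralZl_EFin//; last first.
    exact/measurable_EFinP/measurable_indic.
  rewrite integral_indic// setIT nuE//.
  under [in RHS]eq_integral do rewrite EFinM -muleA.
  rewrite ge0_integralZl_EFin//; last 2 first.
  - by move=> x _; rewrite mule_ge0// lee_fin.
  - by apply: emeasurable_funM => //; exact/measurable_EFinP/measurable_indic.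
  congr (_ * _)%E; rewrite integral_mkcond; apply: eq_integral => x _.
  rewrite patchE indicE; case: ifPn => _; first by rewrite mul1e.
  by rewrite mul0e.
have step n : (\int[nu]_x (f_ n x)%:E = \int[mu]_x ((f_ n x)%:E * (g x)%:E))%E.
  under [LHS]eq_integral do rewrite fimfunE -fsumEFin//.
  rewrite [LHS]ge0_integral_fsum//; last 2 first.
  - by move=> r; apply/measurable_EFinP/measurable_funM => //; exact: measurable_indic.
  - by move=> r x _; rewrite nnfun_muleindic_ge0.
  under [RHS]eq_integral.
    move=> x _; rewrite fimfunE -fsumEFin// ge0_mule_fsuml; last first.
      by move=> r; rewrite nnfun_muleindic_ge0.
    over.
  rewrite [RHS]ge0_integral_fsum//; last 2 first.
  - move=> r; apply: emeasurable_funM => //.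
    by apply/measurable_EFinP/measurable_funM => //; exact: measurable_indic.
  - by move=> r x _; rewrite mule_ge0// ?nnfun_muleindic_ge0// lee_fin.
  apply: eq_fsbigr => r /[!inE] -[x _ rE]; apply: indic_case => //.
  by rewrite -rE.
transitivity (limn (fun n => \int[nu]_x (f_ n x)%:E))%E.
  rewrite -monotone_convergence//=.
  - by apply: eq_integral => x _; apply/esym/cvg_lim => //; exact: cvg_nnsfun_approx.
  - by move=> n; exact/measurable_EFinP/measurable_funTS.
  - by move=> n x _; rewrite lee_fin.
  - by move=> x _ a b ab; rewrite lee_fin; exact/lefP/nd_nnsfun_approx.
under eq_fun do rewrite step.
rewrite -monotone_convergence//=.
- apply: eq_integral => x _; apply/cvg_lim => //.
  have := @cvg_nnsfun_approx _ _ _ _ measurableT _ mf (fun x _ => f0 x) x I.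
  by move=> fx; exact: cvgeZr.
- by move=> n; apply: emeasurable_funM => //; exact/measurable_EFinP/measurable_funTS.
- by move=> n x _; rewrite mule_ge0// lee_fin.
- move=> x _ a b ab; apply: lee_wpmul2r; rewrite ?lee_fin//.
  exact/lefP/nd_nnsfun_approx.
Qed.
End MeasureTools.
(* [normal_prob] is a measure on the alias [measurableTypeR R], whose measure
   display differs from that of [R]: [gauss] is the same measure on [R]. *)
Definition gauss {R : realType} (s : R) : set R -> \bar R := normal_prob 0 s.

Section GaussMeasure.
Context {R : realType} (s : R).

Let gauss0 : gauss s set0 = 0%E.
Proof. exact: measure0. Qed.

Let gauss_ge0 A : (0 <= gauss s A)%E.
Proof. exact: measure_ge0. Qed.

Let gauss_sigma_additive : semi_sigma_additive (gauss s).
Proof. exact: (@measure_semi_sigma_additive _ _ _ (normal_prob 0 s)). Qed.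

HB.instance Definition _ := isMeasure.Build _ _ _
  (gauss s) gauss0 gauss_ge0 gauss_sigma_additive.

Let gauss_setT : gauss s [set: R] = 1%E.
Proof. exact: (@probability_setT _ _ _ (normal_prob 0 s)). Qed.

HB.instance Definition _ :=
  @Measure_isProbability.Build _ _ R (gauss s) gauss_setT.

End GaussMeasure.

(** * Moments and interval bounds of the centred normal law *)

Section Normal.
Context {R : realType}.
Variables (s : R).
Hypothesis s0 : 0 < s.
Local Notation nu := (gauss s).

Lemma integral_normal_prob (f : R -> \bar R) :
  measurable_fun setT f -> (forall x, 0 <= f x)%E ->
  (\int[nu]_x f x = \int[lebesgue_measure]_x (f x * (normal_pdf 0 s x)%:E))%E.
Proof.
move=> mf f0.
have mid : measurable_fun setT (fun x : measurableTypeR R => x : R).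
  by move=> _ B mB; rewrite setTI.
rewrite -(integral_density (nu := normal_prob 0 s) (measurable_normal_pdf _ _)
  (normal_pdf_ge0 _ _) _ mf f0)//.
(* The identity map has [measurableTypeR R] as source and [R] as target, so this pushforward changes
   only the measure display. *)
transitivity (\int[pushforward (normal_prob 0 s) (fun x : measurableTypeR R => x : R)]_x f x)%E.
  exact: eq_measure_integral.
by rewrite (ge0_integral_pushforward mid).
Qed.

Lemma normal_pdf0N x : normal_pdf 0 s (- x) = normal_pdf 0 s x.
Proof. by rewrite !normal_pdfE ?gt_eqF// /normal_fun !subr0 sqrrN. Qed.

Lemma integral_normal_probN (f : R -> \bar R) :
  measurable_fun setT f -> (forall x, 0 <= f x)%E ->
  (\int[nu]_x f (- x)%R = \int[nu]_x f x)%E.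
Proof.
move=> mf f0.
have mfN : measurable_fun setT (fun x : R => f (- x)).
  by apply: measurableT_comp => //; exact: oppr_measurable.
have mg : measurable_fun setT (fun x => (f x * (normal_pdf 0 s x)%:E)%E).
  by apply: emeasurable_funM => //; apply/measurable_EFinP; exact: measurable_normal_pdf.
have g0 x : (0 <= f x * (normal_pdf 0 s x)%:E)%E.
  by rewrite mule_ge0// lee_fin normal_pdf_ge0.
rewrite !integral_normal_prob//.
under eq_integral do rewrite -normal_pdf0N.
rewrite -(@ge0_integral_pushforward _ _ (measurableTypeR R) (measurableTypeR R) _
  (-%R : R -> R) _ lebesgue_measure setT
  (fun x => f x * (normal_pdf 0 s x)%:E)%E)//.
apply: eq_measure_integral => /= A mA _; exact: lebesgue_measureN.
Qed.

(** With [y = 3 * x ^+ 2 / (8 * s ^+ 2)], the exponent of the density of deviation [2 * s] is that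
    of deviation [s] plus [y], and [y <= expR y] absorbs [x ^+ 2 = 8 / 3 * s ^+ 2 * y]. The wider
    density then dominates the second moment. *)
Lemma sqr_normal_pdf_le (x : R) :
  x ^+ 2 * normal_pdf 0 s x <=
  8 / 3 * s ^+ 2 * normal_peak s / normal_peak (2 * s) * normal_pdf 0 (2 * s) x.
Proof.
have s20 : 2 * s != 0 by rewrite mulf_neq0 ?gt_eqF.
rewrite !normal_pdfE ?gt_eqF ?mulr_gt0//.
have p2 := normal_peak_gt0 s20.
rewrite [leRHS]mulrA divfK ?gt_eqF//.
rewrite mulrCA (_ : 8 / 3 * s ^+ 2 * normal_peak s * normal_fun 0 (2 * s) x =
  normal_peak s * (8 / 3 * s ^+ 2 * normal_fun 0 (2 * s) x)); last by ring.
apply: ler_wpM2l; first exact: normal_peak_ge0.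
rewrite /normal_fun !subr0.
pose y : R := 3 * x ^+ 2 / (8 * s ^+ 2).
have ss : 0 < s ^+ 2 by rewrite exprn_gt0.
have -> : - x ^+ 2 / ((2 * s) ^+ 2 *+ 2) = - x ^+ 2 / (s ^+ 2 *+ 2) + y.
  by rewrite /y; field; rewrite gt_eqF.
rewrite expRD [leRHS]mulrCA mulrC.
apply: ler_wpM2l; first exact: expR_ge0.
have -> : x ^+ 2 = 8 / 3 * s ^+ 2 * y by rewrite /y; field; rewrite gt_eqF.
rewrite ler_wpM2l//; first by rewrite !mulr_ge0// ltW.
by have := expR_ge1Dx y; lra.
Qed.

Lemma normal_second_moment_fin : (\int[nu]_x (x ^+ 2)%:E \is a fin_num)%E.
Proof.
have m2 : measurable_fun setT (fun x : R => (x ^+ 2)%:E).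
  by apply/measurable_EFinP; exact: exprn_measurable.
rewrite ge0_fin_numE; last first.
  by apply: integral_ge0 => x _; rewrite lee_fin sqr_ge0.
rewrite integral_normal_prob//; last by move=> x; rewrite lee_fin sqr_ge0.
set C := 8 / 3 * s ^+ 2 * normal_peak s / normal_peak (2 * s).
have C0 : 0 <= C.
  by rewrite /C !mulr_ge0 ?invr_ge0 ?normal_peak_ge0 ?sqr_ge0// ltW.
have mp : measurable_fun setT (fun x : R => (normal_pdf 0 (2 * s) x)%:E).
  by apply/measurable_EFinP; exact: measurable_normal_pdf.
apply: (@le_lt_trans _ _ (\int[lebesgue_measure]_x
    (C%:E * (normal_pdf 0 (2 * s) x)%:E))%E).
  apply: ge0_le_integral => //.
  - by move=> x _; rewrite mule_ge0// lee_fin ?sqr_ge0 ?normal_pdf_ge0.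
  - by apply: emeasurable_funM => //; apply/measurable_EFinP; exact: measurable_normal_pdf.
  - by apply: emeasurable_funM => //; exact: measurable_cst.
  - by move=> x _; rewrite -!EFinM lee_fin sqr_normal_pdf_le.
rewrite ge0_integralZl_EFin//.
- by rewrite integral_normal_pdf mule1 ltry.
- by move=> x _; rewrite lee_fin normal_pdf_ge0.
Qed.

(** No signed function is integrated: the integral is added to its reflection under [x -> - x], and
    the cross terms cancel inside the integrand. One [v] serves all [z]. *)
Lemma normal_sqr_shift : exists2 v : R, 0 <= v &
  forall z : R, (\int[nu]_x ((z + x) ^+ 2)%:E = (z ^+ 2 + v)%:E)%E.
Proof.
pose v := fine (\int[nu]_x (x ^+ 2)%:E)%E.
have vE : (\int[nu]_x (x ^+ 2)%:E = v%:E)%E.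
  by rewrite fineK//; exact: normal_second_moment_fin.
have v0 : 0 <= v.
  by rewrite fine_ge0//; apply: integral_ge0 => x _; rewrite lee_fin sqr_ge0.
exists v => // z.
have m2 (c : R) : measurable_fun setT (fun x : R => ((c + x) ^+ 2)%:E).
  apply/measurable_EFinP/measurable_funX/measurable_funD => //.
have m2N : measurable_fun setT (fun x : R => ((z + - x) ^+ 2)%:E).
  apply/measurable_EFinP/measurable_funX/measurable_funD => //.
have h2 : measurable_fun setT (fun x : R => (x ^+ 2)%:E).
  by apply/measurable_EFinP; exact: exprn_measurable.
set I := (\int[nu]_x _)%E.
have II : (I + I = (z ^+ 2 + v)%:E + (z ^+ 2 + v)%:E)%E.
  rewrite {2}/I -integral_normal_probN//; last first.
    by move=> x; rewrite lee_fin sqr_ge0.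
  rewrite /I -ge0_integralD//; last 2 first.
  - by move=> x _; rewrite lee_fin sqr_ge0.
  - by move=> x _; rewrite lee_fin sqr_ge0.
  transitivity (\int[nu]_x ((z ^+ 2 + z ^+ 2)%:E + (2%:E * (x ^+ 2)%:E)))%E.
    by apply: eq_integral => x _; rewrite -EFinM -!EFinD; congr EFin; ring.
  rewrite ge0_integralD//; last 3 first.
  - by move=> x _; rewrite lee_fin addr_ge0 ?sqr_ge0.
  - by move=> x _; rewrite mule_ge0// lee_fin ?sqr_ge0.
  - by apply: emeasurable_funM => //; exact: measurable_cst.
  rewrite integral_cst// ge0_integralZl_EFin//; last first.
    by move=> x _; rewrite lee_fin sqr_ge0.
  have gT : gauss s setT = 1%E by exact: probability_setT.
  by rewrite /= gT vE mule1 -EFinM -!EFinD; congr EFin; ring.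
have I0 : (0 <= I)%E by apply: integral_ge0 => x _; rewrite lee_fin sqr_ge0.
move: I I0 II => [r _|//|//].
by rewrite -!EFinD => -[rr]; congr EFin; lra.
Qed.

Lemma normal_peak_le : normal_peak s <= s^-1.
Proof.
rewrite /normal_peak lef_pV2 ?posrE//; last first.
  by rewrite sqrtr_gt0 mulrn_wgt0// mulr_gt0 ?exprn_gt0// pi_gt0.
rewrite -[leLHS]gtr0_norm// -sqrtr_sqr ler_wsqrtr//.
rewrite -mulrnAr ler_peMr ?sqr_ge0// -mulr_natl.
by have := pi_ge2 R; lra.
Qed.

Lemma normal_itv_le (a b : R) : a <= b ->
  (nu `]a, b[ <= ((b - a) * normal_peak s)%:E)%E.
Proof.
move=> ab; rewrite /normal_prob.
apply: (@le_trans _ _ (\int[lebesgue_measure]_(x in `]a, b[) (normal_peak s)%:E)%E).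
  apply: ge0_le_integral => //.
  - by move=> x _; rewrite lee_fin normal_pdf_ge0.
  - by apply/measurable_EFinP/measurable_funTS; exact: measurable_normal_pdf.
  - by move=> x _; rewrite lee_fin normal_pdf_ub// gt_eqF.
rewrite integral_cst//= lebesgue_measure_itv/= mulrC EFinM.
case: ifPn => [_|]; first by rewrite -EFinB.
by rewrite mule0 -EFinM lee_fin mulr_ge0 ?normal_peak_ge0 ?subr_ge0.
Qed.

End Normal.

(** * Independence of Brownian increments from the past *)

Section IndependentIncrements.
Context {R : realType} {d : measure_display} {Omega : measurableType d}.
Variable P : probability Omega R.

(** The finite measures sending [A] to the probability of its intersection with [D] and to
    [P A * P D] agree on the pi-system [G], hence on the sigma-algebra it generates. *)
Lemma indep_setI_closed (G : set_system Omega) (D : set Omega) :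
  G `<=` measurable -> setI_closed G -> G setT -> measurable D ->
  (forall A, G A -> P (A `&` D) = (P A * P D)%E) ->
  forall A, <<s G >> A -> P (A `&` D) = (P A * P D)%E.
Proof.
move=> mG GI GT mD GD.
have PD0 : 0 <= fine (P D) by rewrite fine_ge0.
pose m2 : {measure set Omega -> \bar R} := mscale (NngNum PD0) P.
have E A : m2 A = (P A * P D)%E.
  by rewrite /m2 /= /mscale /= fineK ?fin_num_measure// muleC.
move=> A sA; rewrite -E.
apply: (@g_sigma_algebra_measure_unique _ _ _ G mG (fun=> setT) _ _
  (mrestr P mD) m2) => //.
- by rewrite bigcup_const//; exists 0%N.
- by move=> B GB; rewrite E -GD.
- by move=> _; rewrite /= /mrestr setTI -ge0_fin_numE// fin_num_measure.
Qed.

Variable W : R -> Omega -> R.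
Hypothesis hW : standard_BM P W.

Let mW t : measurable_fun setT (W t). Proof. by case: hW. Qed.

Lemma gen_by_measurable (X : R -> Omega -> R) (S : set R) :
  (forall t, S t -> measurable_fun setT (X t)) ->
  gen_by X S `<=` measurable.
Proof.
move=> mX; apply: smallest_sub; first exact: sigma_algebra_measurable.
move=> _ [s [B [Ss [mB ->]]]]; rewrite -[X in measurable X]setTI.
exact: mX.
Qed.

Lemma gen_by_preimage (X : R -> Omega -> R) (S : set R) s B :
  S s -> measurable B -> gen_by X S (X s @^-1` B).
Proof. by move=> Ss mB; apply: sub_sigma_algebra; exists s, B. Qed.

Lemma gen_by_sub (X : R -> Omega -> R) (S S' : set R) :
  S `<=` S' -> gen_by X S `<=` gen_by X S'.
Proof.
move=> SS'; apply: sub_smallest2r; first exact: smallest_sigma_algebra.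
by move=> _ [s [B [Ss [mB ->]]]]; exists s, B; split => //; exact: SS'.
Qed.

Section Grid.
Variables (g : seq R) (T : R).
Hypothesis gT : path <%R 0 (rcons g T).
Let t := last 0 g.
Let D w := W T w - W t w.
Let inc j w := W (nth 0 (0 :: g) j.+1) w - W (nth 0 (0 :: g) j) w.
(** Rectangles in the increments along the grid: the pi-system on which the product formula of
    [standard_BM] can be read off. *)
Let G0 := [set A | exists B : nat -> set R, (forall j, measurable (B j)) /\
  A = \bigcap_(j in `I_(size g)) (inc j @^-1` B j)].

Let mD E : measurable E -> measurable (D @^-1` E).
Proof.
by move=> mE; rewrite -[X in measurable X]setTI; apply: measurable_funB.
Qed.

Let std (j : nat) : R := Num.sqrt (nth (0 : R) (0 :: g) j.+1 - nth (0 : R) (0 :: g) j).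

Let inc_prob (B : nat -> set R) E : (forall j, measurable (B j)) -> measurable E ->
  P ((\bigcap_(j in `I_(size g)) (inc j @^-1` B j)) `&` D @^-1` E) =
  ((\prod_(j < size g) gauss (std j) (B j)) * gauss (Num.sqrt (T - t)) E)%E.
Proof.
move=> mB mE; set k := size g.
have [s sE] : exists s, s = 0 :: rcons g T by exists (0 :: rcons g T).
pose tt (j : 'I_k.+2) : R := nth 0 s j.
(* The increment of index [k] is the one from [t] to [T], so [E] is appended to [B] as its last
   set. *)
pose B' (j : 'I_k.+1) : set R := if (j < k)%N then B j else E.
have mB' j : measurable (B' j) by rewrite /B'; case: ifP.
case: hW => _ _ _ /(_ k.+1 tt B') h.
have n1 (j : nat) : (j <= k)%N -> nth 0 s j = nth 0 (0 :: g) j.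
  by rewrite sE -rcons_cons nth_rcons /= ltnS => ->.
have nT : nth 0 s k.+1 = T by rewrite sE /= nth_rcons ltnn eqxx.
have nt : nth 0 (0 :: g) k = t by rewrite /t (last_nth 0).
have lj (j : 'I_k.+1) : lift ord0 j = j.+1 :> nat by rewrite lift0.
have wj (j : 'I_k.+1) : widen_ord (leqnSn k.+1) j = j :> nat by [].
transitivity (P (\bigcap_(j in [set: 'I_k.+1])
              [set w | W (tt (lift ord0 j)) w - W (tt (widen_ord (leqnSn k.+1) j)) w
                       \in B' j])).
  congr (P _); apply/seteqP; split => w.
    move=> [wB wD] j _; apply/mem_set; rewrite /B' /tt lj wj.
    case: ifPn => jk; first by have := wB j jk; rewrite /preimage /mkset /inc !n1// ltnW.
    have jE : j = k :> nat by apply/eqP; rewrite eqn_leq -ltnS ltn_ord leqNgt.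
    by rewrite jE nT n1// nt.
  move=> wB; split.
    move=> j jk; have /set_mem := wB (Ordinal (leqW jk)) I.
    by rewrite /B' /tt lj wj jk /preimage /mkset /inc !n1// ltnW.
  have /set_mem := wB ord_max I; rewrite /B' /tt lj wj /= ltnn nT n1//.
  by rewrite nt.
rewrite h//.
- pose f (j : nat) := gauss (Num.sqrt (nth 0 s j.+1 - nth 0 s j))
    (if (j < k)%N then B j else E).
  transitivity (\prod_(j < k.+1) f j)%E.
    by apply: eq_bigr => j _; rewrite /tt lj wj.
  have ek : nth 0 s k.+1 - nth 0 s k = T - t.
    by rewrite nT (n1 k (leqnn k)) nt.
  have fk : f k = gauss (Num.sqrt (T - t)) E by rewrite /f ltnn ek.
  have fj (j : 'I_k) : f j = gauss (std j) (B j).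
    have ej : Num.sqrt (nth 0 s j.+1 - nth 0 s j) = std j.
      by rewrite (n1 j.+1 (ltn_ord j)) (n1 j (ltnW (ltn_ord j))).
    by rewrite /f (ltn_ord j); exact: (congr1 (fun x => gauss x (B j)) ej).
  rewrite -fk -(eq_bigr _ (fun j _ => fj j)); exact: big_ord_recr.
- by rewrite /tt /= sE.
- move=> j; rewrite /tt lj wj sE.
  have /pathP - /(_ 0 j) := gT; rewrite size_rcons; apply.
  exact: ltn_ord.
Qed.

Let gaussT s : gauss s [set: R] = 1%E. Proof. exact: probability_setT. Qed.

Let probD E : measurable E -> P (D @^-1` E) = gauss (Num.sqrt (T - t)) E.
Proof.
move=> mE; have := @inc_prob (fun=> setT) E (fun=> measurableT) mE.
rewrite bigcapT ?setTI; last by move=> j _; rewrite preimage_setT.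
by rewrite big1 ?mul1e// => j _; exact: gaussT.
Qed.

Let G0D E A : measurable E -> G0 A -> P (A `&` D @^-1` E) = (P A * P (D @^-1` E))%E.
Proof.
move=> mE [B [mB ->]]; rewrite probD// inc_prob//.
by have := inc_prob mB measurableT; rewrite preimage_setT setIT gaussT mule1 => ->.
Qed.

Let mG0 : G0 `<=` measurable.
Proof.
move=> _ [B [mB ->]]; have [->|g0] := eqVneq (size g) 0%N.
  by rewrite II0 bigcap_set0.
apply: bigcap_measurable => [|j _]; first by exists 0%N; rewrite /= lt0n.
by rewrite -[X in measurable X]setTI; apply: measurable_funB.
Qed.

Let G0I : setI_closed G0.
Proof.
move=> _ _ [B1 [mB1 ->]] [B2 [mB2 ->]]; exists (fun j => B1 j `&` B2 j); split.
  by move=> j; exact: measurableI.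
by rewrite -bigcapI; apply: eq_bigcapr => j _; rewrite preimage_setI.
Qed.

Let G0T : G0 setT.
Proof.
exists (fun=> setT); split => //; rewrite bigcapT//.
Qed.

(** As [W 0 = 0], the value at a grid point is a sum of earlier increments, so [G0] already
    generates the sigma-algebra of the values on the grid. *)
Lemma grid_indep A E : measurable E -> gen_by W [set` 0 :: g] A ->
  P (A `&` D @^-1` E) = (P A * gauss (Num.sqrt (T - t)) E)%E.
Proof.
move=> mE gA; rewrite -probD//.
apply: (indep_setI_closed mG0 G0I G0T (mD mE)) => [B GB|]; first exact: G0D.
move: A gA; apply: smallest_sub; first exact: smallest_sigma_algebra.
have minc j : (j < size g)%N ->
    measurable_fun [set: g_sigma_algebraType G0] (inc j : g_sigma_algebraType G0 -> R).
  move=> jk _ B mB; rewrite setTI; apply: sub_sigma_algebra.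
  exists (fun i => if i == j then B else setT); split.
    by move=> i; case: ifP.
  apply/seteqP; split => w /=.
    by move=> wB i _ /=; case: eqVneq => [->|].
  by move=> /(_ j jk) /=; rewrite eqxx.
have mWg j : (j <= size g)%N ->
    measurable_fun [set: g_sigma_algebraType G0]
      (W (nth 0 (0 :: g) j) : g_sigma_algebraType G0 -> R).
  elim: j => [_|j IH jk].
    rewrite /=; have -> : W 0 = cst 0 by apply/funext => w; case: hW.
    exact: measurable_cst.
  rewrite (_ : W _ = (fun w => W (nth 0 (0 :: g) j) w + inc j w)).
    by apply: measurable_funD; [apply: IH; exact: ltnW|exact: minc].
  by apply/funext => w; rewrite /inc addrC subrK.
move=> _ [r [B [/= rg [mB ->]]]].
have /(nthP 0) [j] : r \in 0 :: g by [].
rewrite /= ltnS => jk <-.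
by have := mWg j jk measurableT B mB; rewrite setTI.
Qed.

End Grid.

(** Events depending on finitely many times in [[0, t]] form a pi-system generating the past, and
    each of them fits on a grid that ends at [t]. *)
Lemma indep_increment (t T : R) (A : set Omega) (E : set R) :
  0 <= t -> t < T -> measurable E -> gen_by W [set s | 0 <= s <= t] A ->
  P (A `&` (fun w => W T w - W t w) @^-1` E) =
  (P A * gauss (Num.sqrt (T - t)) E)%E.
Proof.
move=> t0 tT mE FA.
pose Pi := [set A | exists l : seq R, (forall r, r \in l -> 0 <= r <= t) /\
  gen_by W [set` l] A].
have PiE B : Pi B -> P (B `&` (fun w => W T w - W t w) @^-1` E) =
    (P B * gauss (Num.sqrt (T - t)) E)%E.
  move=> [l [lt gB]].
  (* The grid must be strictly increasing from [0]: duplicates and the time [0] are removed, and [t]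
     is added so that the last increment starts there. It is empty when [t = 0]. *)
  pose g := sort <=%R (undup [seq r <- t :: l | 0 < r]).
  have memg r : (r \in g) = (0 < r) && ((r == t) || (r \in l)).
    by rewrite mem_sort mem_undup mem_filter in_cons.
  have sg : sorted <%R g by rewrite sort_lt_sorted undup_uniq.
  have gt r : r \in g -> 0 < r <= t.
    rewrite memg => /andP[-> /orP[/eqP ->|/lt/andP[_ ->]]]//.
    by rewrite lexx.
  have pg : path <%R 0 g.
    by rewrite lt_path_sortedE sg andbT; apply/allP => r /gt/andP[].
  have lg : last 0 g = t.
    have [t00|t1] := eqVneq t 0.
      have -> : g = [::].
        apply/eqP; rewrite -size_eq0 -leqn0 leqNgt -has_predT; apply/hasPn => r.
        by move=> /gt; rewrite t00 => /andP[r0]; rewrite leNgt r0.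
      by rewrite t00.
    have tg : t \in g by rewrite memg eqxx andbT lt_def t1.
    move: sg tg gt; case/lastP: (g) => // s x; rewrite last_rcons.
    rewrite sorted_pairwise; last exact: lt_trans.
    rewrite pairwise_rcons => /andP[/allP sx _].
    rewrite mem_rcons in_cons => /predU1P[//|/sx tx] /(_ x).
    by rewrite mem_rcons mem_head => /(_ isT) /andP[_]; rewrite leNgt tx.
  have gT : path <%R 0 (rcons g T) by rewrite rcons_path pg lg.
  have := @grid_indep g T gT B E mE; rewrite lg; apply.
  apply: gen_by_sub gB => r /= rl; rewrite in_cons memg rl orbT andbT.
  by have /andP[r0 _] := lt _ rl; rewrite -le0r.
have mPi : Pi `<=` measurable.
  by move=> B [l [_]]; apply: gen_by_measurable => r _; exact: mW.
have PiT : Pi setT.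
  by exists [::]; split => //; exact: (@measurableT _ (g_sigma_algebraType _)).
have PD : P ((fun w => W T w - W t w) @^-1` E) = gauss (Num.sqrt (T - t)) E.
  by have := PiE _ PiT; rewrite setTI probability_setT mul1e.
rewrite -PD; apply: (indep_setI_closed mPi) => //.
- move=> A1 A2 [l1 [l1t gA1]] [l2 [l2t gA2]]; exists (l1 ++ l2); split.
    by move=> r; rewrite mem_cat => /orP[/l1t|/l2t].
  apply: (@measurableI _ (g_sigma_algebraType _)).
    by apply: gen_by_sub gA1 => r /= rl; rewrite mem_cat rl.
  by apply: gen_by_sub gA2 => r /= rl; rewrite mem_cat rl orbT.
- rewrite -[X in measurable X]setTI; apply: measurable_funB => //.
- by move=> B PiB; rewrite PD; exact: PiE.
- move: A FA; apply: smallest_sub; first exact: smallest_sigma_algebra.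
  move=> _ [r [B [rt [mB ->]]]]; apply: sub_sigma_algebra.
  exists [:: r]; split; first by move=> r'; rewrite inE => /eqP ->.
  by apply: gen_by_preimage => //=; rewrite inE.
Qed.

Lemma increment_law (t T : R) (E : set R) : 0 <= t -> t < T -> measurable E ->
  P ((fun w => W T w - W t w) @^-1` E) = gauss (Num.sqrt (T - t)) E.
Proof.
move=> t0 tT mE; have := @indep_increment t T setT E t0 tT mE.
rewrite setTI probability_setT mul1e; apply.
exact: (@measurableT _ (g_sigma_algebraType _)).
Qed.

End IndependentIncrements.

(** * Discretisation of times from above *)

Section Discretisation.
Context {R : realType}.

(** The right end of the cell of mesh [1 / (m + 1)] that contains [r], hence strictly above [r]: the
    cell into which a random time falls is known by the time reported. *)
Definition dsc (m : nat) (r : R) : R := (Num.truncn (r * m.+1%:R)).+1%:R / m.+1%:R.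

Lemma dsc_gt m r : r < dsc m r.
Proof. by rewrite /dsc ltr_pdivlMr// truncnS_gt. Qed.

Lemma dsc_le m r : 0 <= r -> dsc m r <= r + m.+1%:R^-1.
Proof.
move=> r0; rewrite /dsc ler_pdivrMr// mulrDl mulVf// -natr1 lerD2r.
by rewrite truncn_le// mulr_ge0.
Qed.

Lemma dsc_cvg r : 0 <= r -> dsc m r @[m --> \oo] --> r.
Proof.
move=> r0; apply: (@squeeze_cvgr _ _ _ _ (fun=> r) (fun m => r + m.+1%:R^-1)).
- by near=> m; rewrite (ltW (dsc_gt _ _)) dsc_le.
- exact: cvg_cst.
- rewrite -[X in _ --> X]addr0; apply: cvgD; first exact: cvg_cst.
  exact: cvg_harmonic.
Unshelve. all: by end_near. Qed.

Definition cell (m k : nat) : set R := `[k%:R / m.+1%:R, k.+1%:R / m.+1%:R[%classic.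

Lemma measurable_cell m k : measurable (cell m k).
Proof. exact: measurable_itv. Qed.

Lemma cellP m k r : 0 <= r -> cell m k r <-> Num.truncn (r * m.+1%:R) = k.
Proof.
move=> r0; rewrite /cell /= in_itv /= ler_pdivrMr// ltr_pdivlMr//.
by rewrite -truncn_eq ?mulr_ge0//; split => /eqP.
Qed.

Lemma dsc_cell m k r : 0 <= r -> cell m k r -> dsc m r = k.+1%:R / m.+1%:R.
Proof. by move=> r0 /(cellP _ _ r0); rewrite /dsc => ->. Qed.

Lemma bigcup_preimage_cell {T : Type} (f : T -> R) m : (forall x, 0 <= f x) ->
  \bigcup_k (f @^-1` cell m k) = setT.
Proof.
move=> f0; apply/seteqP; split => // x _; exists (Num.truncn (f x * m.+1%:R)) => //.
exact/cellP.
Qed.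

Lemma trivIset_preimage_cell {T : Type} (f : T -> R) m : (forall x, 0 <= f x) ->
  trivIset setT (fun k => f @^-1` cell m k).
Proof.
move=> f0; apply/trivIsetP => i j _ _ /eqP ij; apply/seteqP; split => // x [].
by move=> /(cellP _ _ (f0 x)) fi /(cellP _ _ (f0 x)) fj; apply: ij; rewrite -fi.
Qed.

Lemma within_ge0_cvg_comp (f : R -> R) (u : R^nat) (r : R) :
  {within [set t : R | 0 <= t], continuous f} -> 0 <= r -> (forall n, 0 <= u n) ->
  u @ \oo --> r -> f (u n) @[n --> \oo] --> f r.
Proof.
move=> /subspace_continuousP cf r0 u0 ur.
apply: (@cvg_comp _ _ _ u f _ (within [set t | 0 <= t] (nbhs r))); last exact: cf.
move=> A; rewrite /within /= => nA.
have := ur _ nA; rewrite /nbhs /= => uA; near=> n.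
have : [set t | 0 <= t] (u n) -> A (u n) by near: n; exact: uA.
by apply; exact: u0.
Unshelve. all: by end_near. Qed.

(** On each cell the discretised time is constant, so the value there is one of the [Y t];
    continuity of the paths passes to the limit. *)
Lemma measurable_stopped d (T : measurableType d) (Y : R -> T -> R) (sigma : T -> R) :
  (forall t : R, 0 <= t -> measurable_fun setT (Y t)) ->
  (forall w, {within [set t : R | 0 <= t], continuous (Y ^~ w)}) ->
  measurable_fun setT sigma -> (forall w, 0 <= sigma w) ->
  measurable_fun setT (fun w => Y (sigma w) w).
Proof.
move=> mY cY ms s0.
apply: (@measurable_fun_cvg _ _ _ _ (fun m w => Y (dsc m (sigma w)) w)).
  move=> m; rewrite -(bigcup_preimage_cell m s0).
  apply/measurable_fun_bigcup => k.
    by rewrite -[X in measurable X]setTI; apply: ms => //; exact: measurable_cell.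
  apply: (eq_measurable_fun (Y (k.+1%:R / m.+1%:R))).
    by move=> w /[!inE] /= wk; rewrite (dsc_cell _ wk).
  by apply: measurable_funTS; apply: mY; rewrite divr_ge0.
move=> w _; apply: (within_ge0_cvg_comp (cY w)) => // [m|].
  by rewrite (le_trans (s0 w)) ?ltW ?dsc_gt.
exact: dsc_cvg.
Qed.
End Discretisation.

(** * Optional stopping for Brownian motion at bounded times *)

Section OptionalStopping.
Context {R : realType} {d : measure_display} {Omega : measurableType d}.
Variables (P : probability Omega R) (W : R -> Omega -> R).
Hypothesis hW : standard_BM P W.

(** The past of [W] with the present included. It contains the strict past of the absorbed process
    used by [admissible], and increments after [t] are still independent of it. *)
Definition FW (t : R) : set_system Omega := gen_by W [set s | 0 <= s <= t].

Lemma FW_sub s t : s <= t -> FW s `<=` FW t.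
Proof. by move=> st; apply: gen_by_sub => r /= /andP[-> /le_trans ->]. Qed.

Let mW t : measurable_fun setT (W t). Proof. by case: hW. Qed.

Lemma FW_measurable t : FW t `<=` measurable.
Proof. by apply: gen_by_measurable => s _; exact: mW. Qed.

Let mdiff s t : measurable_fun setT (fun w => W t w - W s w).
Proof. exact: measurable_funB. Qed.

Let msq (a t : R) : measurable_fun setT (fun w => ((a + W t w) ^+ 2)%:E).
Proof.
by apply/measurable_EFinP/measurable_funX; apply: measurable_funD.
Qed.

Let sq_ge0 (x : R) : (0 <= (x ^+ 2)%:E)%E. Proof. by rewrite lee_fin sqr_ge0. Qed.

(** Given the past event [A], the later increment is integrated out by [integral_indep] and only
    adds the nonnegative constant [v]. *)
Lemma integral_sqr_le_terminal (a s T : R) (A : set Omega) :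
  0 <= s -> s <= T -> FW s A ->
  (\int[P]_(w in A) ((a + W s w) ^+ 2)%:E <= \int[P]_(w in A) ((a + W T w) ^+ 2)%:E)%E.
Proof.
move=> s0; rewrite le_eqVlt => /predU1P[->//|sT] FA.
have mA := FW_measurable FA.
have sp : 0 < Num.sqrt (T - s) by rewrite sqrtr_gt0 subr_gt0.
have [v v0 vE] := normal_sqr_shift sp.
have mf : measurable_fun [set: R * R] (fun x : R * R => ((x.1 + x.2) ^+ 2)%:E).
  apply/measurable_EFinP/measurable_funX.
  by apply: measurable_funD; [exact: measurable_fst|exact: measurable_snd].
have mU : measurable_fun setT (fun w => a + W s w) by exact: measurable_funD.
have := @integral_indep R _ _ _ _ _ _ P A (fun w => a + W s w)
  (fun w => W T w - W s w) (gauss (Num.sqrt (T - s)))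
  (fun x : R * R => ((x.1 + x.2) ^+ 2)%:E) mA mU (mdiff s T) _ mf (fun x => sq_ge0 _).
under eq_integral do rewrite /= addrA addrAC addrK.
under [in X in (_ -> _ = X) -> _]eq_integral do rewrite /= vE.
move=> ->; last first.
  move=> C E mC mE; apply: indep_increment => //.
  apply: (@measurableI _ (g_sigma_algebraType _)) => //.
  apply: (@gen_by_preimage _ _ _ _ _ s ((fun x => a + x) @^-1` C)) => /=.
    by rewrite s0 lexx.
  by rewrite -[X in measurable X]setTI; apply: measurable_funD.
apply: ge0_le_integral => //.
- by apply: measurable_funTS.
- by apply/measurable_EFinP/measurable_funTS/measurable_funD => //; exact: measurable_funX.
- by move=> w _; rewrite lee_fin lerDl.
Qed.

(** The point is the order of the quantifiers: one [v] serves all shifts [a]. *)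
Lemma integral_sqr_terminal (T : R) : 0 < T -> exists v : R, forall a : R,
  (\int[P]_w ((a + W T w) ^+ 2)%:E = (a ^+ 2 + v)%:E)%E.
Proof.
move=> T0; have sp : 0 < Num.sqrt (T - 0) by rewrite subr0 sqrtr_gt0.
have [v v0 vE] := normal_sqr_shift sp.
exists v => a.
have mf : measurable_fun [set: R * R] (fun x : R * R => ((x.1 + x.2) ^+ 2)%:E).
  apply/measurable_EFinP/measurable_funX.
  by apply: measurable_funD; [exact: measurable_fst|exact: measurable_snd].
have := @integral_indep R _ _ _ _ _ _ P setT (fun w => a)
  (fun w => W T w - W 0 w) (gauss (Num.sqrt (T - 0)))
  (fun x : R * R => ((x.1 + x.2) ^+ 2)%:E) measurableT (measurable_cst _)
  (mdiff 0 T) _ mf (fun x => sq_ge0 _).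
have W0 w : W 0 w = 0 by case: hW.
under eq_integral do rewrite /= W0 subr0.
under [in X in (_ -> _ = X) -> _]eq_integral do rewrite /= vE.
move=> ->.
  by rewrite integral_prob_cst.
move=> C E mC mE; apply: indep_increment => //.
apply: (@measurableI _ (g_sigma_algebraType _)).
  exact: (@measurableT _ (g_sigma_algebraType _)).
have := @measurable_cst _ _ (g_sigma_algebraType
    [set A | exists t B, [set s0 | 0 <= s0 <= 0] t /\ measurable B /\ A = W t @^-1` B])
    R setT a.
by move=> /(_ measurableT C mC); rewrite setTI.
Qed.

Variables (T : R) (sigma : Omega -> R).
Hypothesis T0 : 0 < T.
Hypothesis s0 : forall w, 0 <= sigma w.
Hypothesis sT : forall w, sigma w <= T.
Hypothesis hs : forall t : R, 0 < t -> FW t [set w | sigma w < t].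

Lemma measurable_stopping : measurable_fun setT sigma.
Proof.
move=> _; apply: (measurability _ (RGenInftyO.measurableE R)) => //.
move=> _ [_ [x ->] <-]; rewrite setTI.
have [x0|x0] := ltP 0 x; last first.
  rewrite [X in measurable X](_ : _ = set0)//.
  by apply/seteqP; split => // w /=; rewrite in_itv /= ltNge (le_trans x0).
apply: (@FW_measurable x).
rewrite [X in FW x X](_ : _ = [set w | sigma w < x]); first exact: hs.
by apply/seteqP; split => w /=; rewrite in_itv.
Qed.

(** The terminal bound is applied cell by cell to the discretised time, which takes countably many
    values, and Fatou's lemma passes to [sigma]. *)
Lemma integral_sqr_stopped_le (a : R) :
  (\int[P]_w ((a + W (sigma w) w) ^+ 2)%:E <= \int[P]_w ((a + W T w) ^+ 2)%:E)%E.
Proof.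
have cW w : {within [set t | 0 <= t], continuous (W ^~ w)} by case: hW.
(* Capping at [T] keeps the rounded time within the horizon; on cells whose right end reaches [T]
   the two integrands coincide. *)
pose s_ m w := Num.min T (dsc m (sigma w)).
have s_ge0 m w : 0 <= s_ m w.
  by rewrite /s_ le_min (ltW T0)/= (le_trans (s0 w)) ?ltW ?dsc_gt.
have ms_ m w k : cell m k (sigma w) -> s_ m w = Num.min T (k.+1%:R / m.+1%:R).
  by move=> wk; rewrite /s_ (dsc_cell _ wk).
have mcell m k : measurable (sigma @^-1` cell m k).
  rewrite -[X in measurable X]setTI; apply: measurable_stopping => //; exact: measurable_cell.
have mf m : measurable_fun setT (fun w => ((a + W (s_ m w) w) ^+ 2)%:E).
  rewrite -(bigcup_preimage_cell m s0); apply/measurable_fun_bigcup => // k.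
  apply: (eq_measurable_fun
      (fun w => ((a + W (Num.min T (k.+1%:R / m.+1%:R)) w) ^+ 2)%:E)).
    by move=> w /[!inE] /= /ms_ ->.
  exact: measurable_funTS.
have le_m m : (\int[P]_w ((a + W (s_ m w) w) ^+ 2)%:E <=
    \int[P]_w ((a + W T w) ^+ 2)%:E)%E.
  rewrite -(bigcup_preimage_cell m s0) !ge0_integral_bigcup//; first last.
  - exact: trivIset_preimage_cell.
  - by rewrite bigcup_preimage_cell.
  - exact: trivIset_preimage_cell.
  - by rewrite bigcup_preimage_cell.
  apply: lee_nneseries => [k *|k _]; first by apply: integral_ge0 => w _.
  pose s := Num.min T (k.+1%:R / m.+1%:R).
  have -> : (\int[P]_(x in sigma @^-1` cell m k) ((a + W (s_ m x) x) ^+ 2)%:E =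
      \int[P]_(x in sigma @^-1` cell m k) ((a + W s x) ^+ 2)%:E)%E.
    by apply: eq_integral => w /[!inE] /ms_ ->.
  have [|] := leP T (k.+1%:R / m.+1%:R) => Tk.
    by rewrite /s min_l.
  rewrite /s min_r ?(ltW Tk)//.
  have k0 : 0 < k.+1%:R / m.+1%:R :> R by rewrite divr_gt0.
  apply: integral_sqr_le_terminal; [exact: ltW|exact: ltW|].
  have -> : sigma @^-1` cell m k = [set w | sigma w < k.+1%:R / m.+1%:R] `&`
      ~` [set w | sigma w < k%:R / m.+1%:R].
    apply/seteqP; split => w; rewrite /preimage /cell /= in_itv /=.
      by move=> /andP[kw ->]; split => //; apply/negP; rewrite -leNgt.
    by move=> [-> /negP]; rewrite -leNgt => ->.
  apply: (@measurableI _ (g_sigma_algebraType _)); first exact: hs.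
  apply: (@measurableC _ (g_sigma_algebraType _)).
  (* [hs] speaks of positive times only; for the first cell the set removed is empty because [sigma]
     is nonnegative. *)
  have [->|k00] := eqVneq k 0%N.
    rewrite mul0r [X in measurable X](_ : _ = set0); last first.
      by apply/seteqP; split => // w /=; rewrite ltNge s0.
    exact: (@measurable0 _ (g_sigma_algebraType _)).
  apply: (@FW_sub (k%:R / m.+1%:R)).
    by rewrite ler_pM2r ?invr_gt0// ler_nat.
  by apply: hs; rewrite divr_gt0// ltr0n lt0n.
have lim_m w : ((a + W (s_ m w) w) ^+ 2)%:E @[m --> \oo] -->
    ((a + W (sigma w) w) ^+ 2)%:E.
  apply: cvg_EFin; first by near=> m.
  have sW : s_ m w @[m --> \oo] --> sigma w.
    apply: (@squeeze_cvgr _ _ _ _ (fun=> sigma w) (fun m => dsc m (sigma w))).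
    - by near=> m; rewrite /s_ ge_min lexx orbT andbT le_min sT ltW// dsc_gt.
    - exact: cvg_cst.
    - exact: dsc_cvg.
  have WW := within_ge0_cvg_comp (cW w) (s0 w) (fun m => s_ge0 m w) sW.
  rewrite /= !expr2; apply: cvgM; (apply: cvgD; [exact: cvg_cst|exact: WW]).
have := @fatou _ _ _ P setT measurableT _ mf (fun n x _ => sq_ge0 _).
under eq_integral do rewrite (cvg_limn_einf_sup (lim_m _)).1.
move=> /le_trans; apply.
rewrite limn_einf_lim; apply: lime_le; first exact: is_cvg_einfs.
near=> n; apply: ereal_inf_le; exists (\int[P]_w ((a + W (s_ n w) w) ^+ 2)%:E)%E => //.
by exists n => /=.
Unshelve. all: by end_near. Qed.

Lemma measurable_W_stopped : measurable_fun setT (fun w => W (sigma w) w).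
Proof.
apply: measurable_stopped => //; first by case: hW.
exact: measurable_stopping.
Qed.

(* [E (a + W_sigma)^2 <= a^2 + v] for every [a] forces [E W_sigma = 0]. *)
Lemma optional_stopping :
  P.-integrable setT (fun w => (W (sigma w) w)%:E) /\
  (\int[P]_w (W (sigma w) w)%:E = 0)%E.
Proof.
have [v vE] := integral_sqr_terminal T0.
pose S w := W (sigma w) w.
have mS : measurable_fun setT S := measurable_W_stopped.
have mS2 : measurable_fun setT (fun w => (S w ^+ 2)%:E).
  exact/measurable_EFinP/measurable_funX.
have le a : (\int[P]_w ((a + S w) ^+ 2)%:E <= (a ^+ 2 + v)%:E)%E.
  by rewrite -vE; exact: integral_sqr_stopped_le.
have iS2 : P.-integrable setT (fun w => (S w ^+ 2)%:E).
  apply/integrableP; split => //.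
  under eq_integral do rewrite gee0_abs//.
  apply: le_lt_trans (ltry (0 ^+ 2 + v)).
  apply: le_trans (le 0); rewrite le_eqVlt; apply/orP; left; apply/eqP.
  by apply: eq_integral => w _; rewrite add0r.
have i1 : P.-integrable setT (cst 1%:E : Omega -> \bar R).
  exact: finite_measure_integrable_cst.
have iS : P.-integrable setT (EFin \o S).
  apply: (le_integrable measurableT _ _ (integrableD measurableT i1 iS2)).
  - exact/measurable_EFinP.
  - move=> w _ /=; rewrite lee_fin [leRHS]ger0_norm ?addr_ge0 ?sqr_ge0//.
    have [S1|/ltW S1] := leP `|S w| 1; first by rewrite (le_trans S1)// lerDl sqr_ge0.
    rewrite -real_normK ?num_real// ler_wpDl// expr2 ler_peMl//.
split=> //.
have [q qE] : exists q, (\int[P]_w (S w ^+ 2)%:E = q%:E)%E.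
  exists (fine (\int[P]_w (S w ^+ 2)%:E)%E); rewrite fineK//.
  exact: integrable_fin_num.
have [e eE] : exists e, (\int[P]_w (EFin \o S) w = e%:E)%E.
  exists (fine (\int[P]_w (EFin \o S) w)%E); rewrite fineK//.
  exact: integrable_fin_num.
have main a : 2 * a * e + q <= v.
  have := le a.
  have -> : (\int[P]_w ((a + S w) ^+ 2)%:E =
      \int[P]_w (((a ^+ 2)%:E + (2 * a)%:E * (EFin \o S) w) + (S w ^+ 2)%:E))%E.
    apply: eq_integral => w _ /=; rewrite -EFinM -!EFinD; congr EFin; ring.
  have ia : P.-integrable setT (cst (a ^+ 2)%:E : Omega -> \bar R).
    exact: finite_measure_integrable_cst.
  have iaS : P.-integrable setT (fun w => (2 * a)%:E * (EFin \o S) w)%E.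
    exact: integrableZl.
  rewrite integralD//; last exact: integrableD.
  rewrite integralD// integralZl// eE qE integral_prob_cst.
  by rewrite -EFinM -!EFinD lee_fin; lra.
rewrite [LHS]eE; congr EFin; apply/eqP/negPn/negP => e0.
(* This [a] makes the left side of [main] equal to [v + 1]. *)
have := main ((v - q + 1) / (2 * e)).
rewrite (_ : 2 * ((v - q + 1) / (2 * e)) * e = v - q + 1); last by field.
lra.
Qed.

End OptionalStopping.

(** * Continuous paths: first hits, running maxima, absorption *)

Section Paths.
Context {R : realType}.
Implicit Types (f : R -> R) (s t : R).
Local Notation cts f := {within [set t : R | 0 <= t], continuous f}.

Lemma cts_itv f a b : 0 <= a -> cts f -> {within `[a, b], continuous f}.
Proof.
move=> a0; apply: continuous_subspaceW => x /=; rewrite in_itv /= => /andP[ax _].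
exact: le_trans ax.
Qed.

Lemma cts_near f s (e : R) : cts f -> 0 <= s -> 0 < e ->
  exists2 r : R, 0 < r & forall x : R, 0 <= x -> `|s - x| < r -> `|f s - f x| < e.
Proof.
move=> /subspace_continuousP /(_ s) + s0 e0 => /(_ s0) /cvgrPdist_lt /(_ e e0).
rewrite /within /= => /nbhs_ballP [r /= r0 hr]; exists r => // x x0 sx.
exact: hr.
Qed.

(** Compactness gives a minimiser on [[0, t]]; were the minimum positive, some [1 / (k + 1)] would
    lie below it. Rational times strictly before [t] suffice, which matters because admissibility
    sees only the strict past. *)
Lemma ex_le0_dense f t : cts f -> 0 < t ->
  (exists2 s : R, 0 <= s <= t & f s <= 0) <->
  (forall k : nat, exists2 q : rat, 0 <= (ratr q : R) < t & f (ratr q) < k.+1%:R^-1).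
Proof.
move=> cf t0; split=> [[s /andP[s0 st] fs] k|h].
  have k0 : 0 < k.+1%:R^-1 :> R by [].
  have [r r0 hr] := cts_near cf s0 k0.
  (* The rational is sought near [s] and inside [(0, t)], so that [s = 0] and [s = t] are covered as
     well. *)
  have : Num.max 0 (s - r) < Num.min t (s + r).
    rewrite gt_max !lt_min t0 /= ltr_wpDl//=.
    by apply/andP; split; lra.
  move=> /rat_in_itvoo[q]; rewrite in_itv/= gt_max lt_min => /andP[/andP[q0 sq] /andP[qt qs]].
  exists q; first by rewrite (ltW q0).
  have := hr _ (ltW q0).
  have -> : `|s - ratr q| < r by rewrite ltr_norml; apply/andP; split; lra.
  by move=> /(_ isT); move: (k.+1%:R^-1) => e; rewrite ltr_norml => /andP[? ?]; lra.
have [c + fc] := EVT_min (ltW t0) (cts_itv (lexx 0) cf).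
rewrite in_itv/= => c0t; exists c => //.
rewrite leNgt; apply/negP => fc0.
have [k kfc] : exists k : nat, k.+1%:R^-1 < f c.
  exists (Num.truncn (f c)^-1).
  by rewrite invf_plt ?posrE// truncnS_gt.
have [q /andP[q0 qt] fq] := h k.
have : f c <= f (ratr q) by apply: fc; rewrite in_itv/= q0 ltW.
by rewrite leNgt (lt_trans fq).
Qed.

(** Entry into a closed half-line. For continuous paths starting above [0] it agrees with [hit0];
    applied to [a - f] it is the first passage to the level [a]. *)
Definition first_hit f : \bar R :=
  ereal_inf [set t%:E | t in [set t : R | 0 <= t /\ f t <= 0]].

Lemma first_hit_ge0 f : (0 <= first_hit f)%E.
Proof. by apply: le_ereal_inf_tmp => _ [t [t0 _] <-]; rewrite lee_fin. Qed.

(** The infimum is attained: were there no hit up to [t], there would be hits in every interval to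
    the right of [t], and continuity would make [t] itself one. *)
Lemma first_hit_le f t : cts f ->
  (first_hit f <= t%:E)%E <-> exists2 s : R, 0 <= s <= t & f s <= 0.
Proof.
move=> cf; split=> [ht|[s /andP[s0 st] fs]]; last first.
  apply: (@le_trans _ _ s%:E); last by rewrite lee_fin.
  by apply: ereal_inf_lbound; exists s.
have t0 : 0 <= t by rewrite -lee_fin (le_trans (first_hit_ge0 f)).
have [//|nex] := pselect (exists2 s : R, 0 <= s <= t & f s <= 0).
have u_ex (n : nat) : exists s : R, t < s < t + n.+1%:R^-1 /\ f s <= 0.
  have : (first_hit f < (t + n.+1%:R^-1)%:E)%E.
    by rewrite (le_lt_trans ht)// lte_fin ltrDl.
  move=> /ereal_inf_lt [_ [s [s0 fs] <-]]; rewrite lte_fin => st.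
  exists s; split => //; rewrite st andbT ltNge; apply/negP => st'.
  by apply: nex; exists s => //; rewrite s0.
have [u uP] := choice u_ex.
have ut : u @ \oo --> t.
  apply: (@squeeze_cvgr _ _ _ _ (fun=> t) (fun n => t + n.+1%:R^-1)).
  - by near=> n; have [/andP[/ltW -> /ltW ->]] := uP n.
  - exact: cvg_cst.
  - rewrite -[X in _ --> X]addr0; apply: cvgD; first exact: cvg_cst.
    exact: cvg_harmonic.
have u0 n : 0 <= u n by have [/andP[/ltW/(le_trans t0)]] := uP n.
have fu := within_ge0_cvg_comp cf t0 u0 ut.
exists t; first by rewrite t0 lexx.
rewrite -(cvg_lim _ fu)//; apply: limr_le; first by apply/cvg_ex; exists (f t).
by near=> n; have [] := uP n.
Unshelve. all: by end_near. Qed.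

Lemma first_hit_gt0 f r s : cts f -> first_hit f = r%:E -> 0 <= s -> s < r -> 0 < f s.
Proof.
move=> cf hr s0 sr; rewrite ltNge; apply/negP => fs.
have : (first_hit f <= s%:E)%E.
  by apply/(first_hit_le _ cf); exists s => //; rewrite s0 lexx.
by rewrite hr lee_fin leNgt sr.
Qed.

Lemma first_hitP f r : cts f -> first_hit f = r%:E -> 0 < f 0 ->
  0 < r /\ f r = 0.
Proof.
move=> cf hr f0.
have [s /andP[s0 sr] fs] : exists2 s : R, 0 <= s <= r & f s <= 0.
  by apply/(first_hit_le _ cf); rewrite hr.
have lt := first_hit_gt0 cf hr.
have rs : s = r.
  apply/eqP; rewrite eq_le sr /= leNgt; apply/negP => /(lt _ s0).
  by rewrite ltNge fs.
rewrite {}rs in s0 sr fs.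
have r0 : 0 < r.
  by rewrite lt_def s0 andbT; apply/eqP => r0; move: fs; rewrite r0 leNgt f0.
split => //; apply/eqP; rewrite eq_le fs /= leNgt; apply/negP => fr0.
have [|c] := @IVT _ f 0 r (f r / 2) s0 (cts_itv (lexx 0) cf).
  by rewrite ge_min le_max; apply/andP; split; apply/orP; [right|left]; lra.
rewrite in_itv/= => /andP[c0 cr] fc.
have /(lt _ c0) : c < r.
  by rewrite lt_def cr andbT; apply/eqP => rc; move: fc; rewrite -rc; lra.
by rewrite fc; lra.
Qed.

Lemma first_hit_infty f s : first_hit f = +oo%E -> 0 <= s -> 0 < f s.
Proof.
move=> hf s0; rewrite ltNge; apply/negP => fs.
have : (first_hit f <= s%:E)%E by apply: ereal_inf_lbound; exists s.
by rewrite hf.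
Qed.

Lemma cts_intro f : (forall s e : R, 0 <= s -> 0 < e -> exists2 r : R, 0 < r &
  forall x : R, 0 <= x -> `|s - x| < r -> `|f s - f x| < e) -> cts f.
Proof.
move=> h; apply/subspace_continuousP => s s0; apply/cvgrPdist_lt => e e0.
have [r r0 hr] := h s e s0 e0.
rewrite /within /=; apply/nbhs_ballP; exists r => // x sx x0.
exact: hr.
Qed.

Definition runmax f t := sup [set f s | s in `[0, t]].

Lemma runmaxP f t : cts f -> 0 <= t ->
  exists2 c : R, 0 <= c <= t & runmax f t = f c /\ forall s : R, 0 <= s <= t -> f s <= f c.
Proof.
move=> cf t0; have [c + fc] := EVT_max t0 (cts_itv (lexx 0) cf).
rewrite in_itv/= => c0t; exists c => //.
have ub s : 0 <= s <= t -> f s <= f c by move=> st; apply: fc; rewrite in_itv.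
split => //; apply/eqP; rewrite eq_le; apply/andP; split.
  apply: ge_sup; first by exists (f c), c => //=; rewrite in_itv.
  by move=> y [s /=]; rewrite in_itv/= => /ub fsc <-.
apply: ub_le_sup; last by exists c => //=; rewrite in_itv.
by exists (f c) => y [s /=]; rewrite in_itv/= => /ub fsc <-.
Qed.

Lemma le_runmax f s t : cts f -> 0 <= s -> s <= t -> f s <= runmax f t.
Proof.
move=> cf s0 st; have [c _ [-> ub]] := runmaxP cf (le_trans s0 st).
by apply: ub; rewrite s0.
Qed.

Lemma runmax_homo f s t : cts f -> 0 <= s -> s <= t -> runmax f s <= runmax f t.
Proof.
move=> cf s0 st; have [c /andP[c0 cs] [-> _]] := runmaxP cf s0.
by apply: le_runmax => //; exact: le_trans st.
Qed.

Lemma runmax0 f : cts f -> runmax f 0 = f 0.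
Proof.
move=> cf; have [c /andP[c0 c1] [-> _]] := runmaxP cf (lexx 0).
by congr f; apply/eqP; rewrite eq_le c1.
Qed.

Lemma runmax_ge f a t : cts f -> 0 <= t ->
  (a <= runmax f t) <-> exists2 s : R, 0 <= s <= t & a - f s <= 0.
Proof.
move=> cf t0; split=> [|[s /andP[s0 st]]].
  by have [c c0t [-> _]] := runmaxP cf t0; exists c => //; rewrite subr_le0.
by rewrite subr_le0 => /le_trans; apply; exact: le_runmax.
Qed.

Lemma runmax_le_osc f u v e : cts f -> 0 <= u -> u <= v -> 0 <= e ->
  (forall z : R, u <= z <= v -> f z <= f u + e) -> runmax f v <= runmax f u + e.
Proof.
move=> cf u0 uv e0 he; have [c /andP[c0 cv] [-> _]] := runmaxP cf (le_trans u0 uv).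
have [cu|/ltW uc] := leP c u; first by rewrite ler_wpDr// le_runmax.
rewrite (le_trans (he c _)) ?uc//.
by rewrite lerD2r le_runmax.
Qed.

Lemma cts_runmax f : cts f -> cts (runmax f).
Proof.
move=> cf; apply: cts_intro => s e s0 e0.
(* Values near [s] differ from [f s] by less than [e / 3], so the path rises by at most
   [2 * (e / 3)] between two such times, and so does its running maximum. *)
have e30 : 0 < e / 3 by lra.
have [r r0 hr] := cts_near cf s0 e30; exists r => // x x0 sx.
have osc u v : 0 <= u -> u <= v -> `|s - u| < r -> `|s - v| < r ->
    `|runmax f v - runmax f u| < e.
  move=> u0 uv su sv.
  have le1 : runmax f v <= runmax f u + 2 * (e / 3).
    apply: runmax_le_osc => //; first lra.
    move=> z /andP[uz zv].
    have sz : `|s - z| < r.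
      by move: su sv; rewrite !ltr_norml => /andP[? ?] /andP[? ?]; apply/andP; split; lra.
    have := hr z (le_trans u0 uz) sz; have := hr u u0 su.
    by rewrite !ltr_norml => /andP[? ?] /andP[? ?]; lra.
  have le2 := runmax_homo cf u0 uv.
  by rewrite ger0_norm; lra.
have ss : `|s - s| < r by rewrite subrr normr0.
have [sx'|/ltW xs] := leP s x; last exact: osc.
by rewrite distrC; exact: osc.
Qed.

Lemma hit0E {d : measure_display} {Omega : measurableType d} (Y : R -> Omega -> R) w :
  cts (Y ^~ w) -> 0 < Y 0 w -> hit0 Y w = first_hit (Y ^~ w).
Proof.
move=> cY Y0; apply/eqP; rewrite eq_le; apply/andP; split; last first.
  apply: le_ereal_inf => _ [t [t0 Yt] <-]; exists t => //; split => //.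
  by rewrite Yt.
apply: le_ereal_inf_tmp => _ [t [t0 Yt] <-].
have [|c] := @IVT _ (Y ^~ w) 0 t 0 t0 (cts_itv (lexx 0) cY).
  by rewrite ge_min le_max Yt (ltW Y0) orbT.
rewrite in_itv/= => /andP[c0 ct] Yc.
apply: (@le_trans _ _ c%:E); last by rewrite lee_fin.
by apply: ereal_inf_lbound; exists c.
Qed.

Section Absorption.
Variables (f g : R -> R).
Hypotheses (cf : cts f) (f0 : 0 < f 0).
Hypothesis gE : forall t : R, 0 <= t -> g t = if (t%:E <= first_hit f)%E then f t else 0.

Lemma absorbed_infty t : first_hit f = +oo%E -> 0 <= t -> g t = f t.
Proof. by move=> h t0; rewrite gE// h leey. Qed.

Lemma absorbed_fin r t : first_hit f = r%:E -> 0 <= t -> g t = f (Num.min t r).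
Proof.
move=> h t0; rewrite gE// h lee_fin; case: ifPn => [tr|]; first by rewrite min_l.
by rewrite -ltNge => /ltW rt; rewrite min_r//; have [_ ->] := first_hitP cf h f0.
Qed.

Lemma absorbed_cts : cts g.
Proof.
have := first_hit_ge0 f; case hf : (first_hit f) => [r|//|//] _.
  have [r0 fr] := first_hitP cf hf f0.
  apply: cts_intro => s e s0 e0.
  have m0 x : 0 <= x -> 0 <= Num.min x r by move=> x0; rewrite le_min x0 ltW.
  have [q q0 hq] := cts_near cf (m0 _ s0) e0; exists q => // x x0 sx.
  rewrite !(absorbed_fin hf)//; apply: hq; first exact: m0.
  apply: le_lt_trans sx.
  rewrite /Num.min; case: ifPn => sr; case: ifPn => xr //.
  - rewrite -leNgt in xr.
    by rewrite ler_norml; apply/andP; split; [|]; have := ler_norm (s - x); have := ler_norm (x - s); rewrite distrC; lra.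
  - rewrite -leNgt in sr.
    by rewrite ler_norml; apply/andP; split; [|]; have := ler_norm (s - x); have := ler_norm (x - s); rewrite distrC; lra.
  - by rewrite subrr normr0.
apply: cts_intro => s e s0 e0; have [q q0 hq] := cts_near cf s0 e0; exists q => // x x0 sx.
by rewrite !absorbed_infty//; exact: hq.
Qed.

Lemma absorbed0 : g 0 = f 0.
Proof. by rewrite gE// first_hit_ge0. Qed.

Lemma absorbed_ge0 t : 0 <= t -> 0 <= g t.
Proof.
move=> t0; have := first_hit_ge0 f; case hf : (first_hit f) => [r|//|//] _.
  have [r0 fr] := first_hitP cf hf f0.
  rewrite (absorbed_fin hf)//; have [tr|rt] := ltP t r; last by rewrite fr.
  exact/ltW/(first_hit_gt0 cf hf).
by rewrite absorbed_infty// ltW// first_hit_infty.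
Qed.

Lemma absorbed_first_hit : first_hit g = first_hit f.
Proof.
have := first_hit_ge0 f; case hf : (first_hit f) => [r|//|//] _.
  have [r0 fr] := first_hitP cf hf f0.
  apply/eqP; rewrite eq_le; apply/andP; split.
    apply/(first_hit_le _ absorbed_cts); exists r; first by rewrite ltW/=.
    by rewrite (absorbed_fin hf) ?minxx ?fr// ltW.
  apply: le_ereal_inf_tmp => _ [t [t0 gt] <-]; rewrite lee_fin leNgt; apply/negP => tr.
  move: gt; rewrite (absorbed_fin hf)// min_l ?(ltW tr)// leNgt.
  by rewrite (first_hit_gt0 cf hf).
apply/eqP; rewrite eq_le leey /=; apply: le_ereal_inf_tmp => _ [t [t0 gt] <-].
by move: gt; rewrite absorbed_infty// leNgt first_hit_infty.
Qed.

End Absorption.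

End Paths.

(** * Measurability of hitting times and stability of stopping times *)

Section HittingTimes.
Context {R : realType} {d : measure_display} {Omega : measurableType d}.
Local Notation cts f := {within [set t : R | 0 <= t], continuous f}.

(** Only the [Z s] with [s < t] have to be measurable, thanks to the dense times of [ex_le0_dense];
    this yields stopping times for a filtration that omits the present. *)
Lemma measurable_ex_le0 d' (T : measurableType d') (Z : R -> T -> R) (t : R) :
  (forall w, cts (Z ^~ w)) -> 0 < t ->
  (forall s : R, 0 <= s < t -> measurable_fun setT (Z s)) ->
  measurable [set w | exists2 s : R, 0 <= s <= t & Z s w <= 0].
Proof.
move=> cZ t0 mZ.
rewrite [X in measurable X](_ : _ = \bigcap_(k : nat) \bigcup_(q : rat)
   [set w | 0 <= (ratr q : R) < t /\ Z (ratr q) w < k.+1%:R^-1]).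
  apply: bigcapT_measurable => k; apply: bigcupT_measurable_rat => q.
  have [qt|qt] := boolP (0 <= (ratr q : R) < t); last first.
    by rewrite [X in measurable X](_ : _ = set0)//; apply/seteqP; split => // w [].
  rewrite [X in measurable X](_ : _ = setT `&` Z (ratr q) @^-1` `]-oo, k.+1%:R^-1[).
    exact: mZ.
  by apply/seteqP; split => w /=; rewrite in_itv/= => -[].
apply/seteqP; split => w.
  by move=> /(ex_le0_dense (cZ w) t0) h k _; have [q qt Zq] := h k; exists q.
move=> h; apply/(ex_le0_dense (cZ w) t0) => k.
by have [q _ [qt Zq]] := h k I; exists q.
Qed.

Lemma cts_subl (f : R -> R) (a : R) : cts f -> cts (fun s => a - f s).
Proof.
move=> cf; apply: cts_intro => s e s0 e0; have [r r0 hr] := cts_near cf s0 e0.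
exists r => // x x0 /(hr x x0).
have -> : a - f s - (a - f x) = - (f s - f x) by ring.
by rewrite normrN.
Qed.

Lemma measurable_runmax d' (T : measurableType d') (Z : R -> T -> R) (t : R) :
  (forall w, cts (Z ^~ w)) -> 0 <= t ->
  (forall s : R, 0 <= s <= t -> measurable_fun setT (Z s)) ->
  measurable_fun setT (fun w => runmax (Z ^~ w) t).
Proof.
move=> cZ t0 mZ.
have [t00|t1] := eqVneq t 0.
  have -> : (fun w => runmax (Z ^~ w) t) = Z 0.
    by apply/funext => w; rewrite t00 runmax0.
  by apply: mZ; rewrite lexx.
have {}t1 : 0 < t by rewrite lt_def t1.
move=> _; apply: (measurability _ (RGenCInfty.measurableE R)) => //.
move=> _ [_ [a ->] <-]; rewrite setTI.
rewrite [X in measurable X](_ : _ = [set w | exists2 s : R, 0 <= s <= t & a - Z s w <= 0]).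
  apply: measurable_ex_le0 => // [w|s /andP[s0 st]]; first exact: cts_subl.
  by apply: measurable_funB => //; apply: mZ; rewrite s0 ltW.
apply/seteqP; split => w /=.
  by rewrite in_itv/= andbT => /(runmax_ge _ (cZ w) t0).
by rewrite in_itv/= andbT => /(runmax_ge _ (cZ w) t0).
Qed.

Lemma measurable_time d' (T : measurableType d') (tau : T -> \bar R) :
  (forall w, 0 <= tau w)%E ->
  (forall t : R, 0 <= t -> measurable [set w | (tau w <= t%:E)%E]) ->
  measurable_fun setT tau.
Proof.
move=> s0 ms _; apply: (measurability _ (ErealGenOInfty.measurableE R)) => //.
move=> _ [_ [r ->] <-]; rewrite setTI.
have [r0|r0] := leP 0 r; last first.
  rewrite [X in measurable X](_ : _ = setT)//; apply/seteqP; split => // w _ /=.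
  by rewrite in_itv/= andbT (lt_le_trans _ (s0 w))// lte_fin.
rewrite [X in measurable X](_ : _ = ~` [set w | (tau w <= r%:E)%E]).
  by apply: measurableC; exact: ms.
by apply/seteqP; split => w /=; rewrite in_itv/= andbT ltNge => /negP.
Qed.

Lemma gen_by_measurable_fun (X : R -> Omega -> R) (S : set R) s :
  S s -> measurable_fun [set: g_sigma_algebraType
    [set A | exists s B, S s /\ measurable B /\ A = X s @^-1` B]]
    (X s : g_sigma_algebraType _ -> R).
Proof. by move=> Ss _ B mB; rewrite setTI; exact: gen_by_preimage. Qed.

Lemma gen_by_gen_by (X Y : R -> Omega -> R) (S S' : set R) :
  (forall s B, S s -> measurable B -> gen_by Y S' (X s @^-1` B)) ->
  gen_by X S `<=` gen_by Y S'.
Proof.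
move=> h; apply: smallest_sub; first exact: smallest_sigma_algebra.
by move=> _ [s [B [Ss [mB ->]]]]; exact: h.
Qed.

Variables (P : probability Omega R) (W : R -> Omega -> R).
Hypothesis hW : standard_BM P W.
Let mW t : measurable_fun setT (W t). Proof. by case: hW. Qed.

Definition stopping (sigma : Omega -> \bar R) :=
  (forall w, 0 <= sigma w)%E /\
  forall t : R, 0 <= t -> FW W t [set w | (sigma w <= t%:E)%E].

Lemma FW_setC t A : FW W t A -> FW W t (~` A).
Proof. exact: (@measurableC _ (g_sigma_algebraType _)). Qed.

Lemma FW_setT t : FW W t setT.
Proof. exact: (@measurableT _ (g_sigma_algebraType _)). Qed.

Lemma FW_setU t A B : FW W t A -> FW W t B -> FW W t (A `|` B).
Proof. exact: (@measurableU _ (g_sigma_algebraType _)). Qed.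

Lemma FW_bigcup t (A : (set Omega)^nat) : (forall n, FW W t (A n)) -> FW W t (\bigcup_n A n).
Proof. exact: (@bigcupT_measurable _ (g_sigma_algebraType _)). Qed.

Lemma stopping_min s1 s2 : stopping s1 -> stopping s2 ->
  stopping (fun w => mine (s1 w) (s2 w)).
Proof.
move=> [s10 m1] [s20 m2]; split=> [w|t t0]; first by rewrite le_min s10 s20.
rewrite (_ : [set w | _] = [set w | (s1 w <= t%:E)%E] `|` [set w | (s2 w <= t%:E)%E]).
  by apply: FW_setU; [exact: m1|exact: m2].
by apply/seteqP; split => w /=; rewrite ge_min => /orP.
Qed.

Definition capped (sigma : Omega -> \bar R) (T : R) (w : Omega) : R :=
  fine (mine (sigma w) T%:E).

Lemma capped_fin sigma T w r : sigma w = r%:E -> capped sigma T w = Num.min r T.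
Proof. by rewrite /capped => ->; rewrite -EFin_min. Qed.

Lemma capped_infty sigma T w : sigma w = +oo%E -> capped sigma T w = T.
Proof. by rewrite /capped => ->; rewrite min_r ?leey. Qed.

Lemma cappedE sigma T w : (0 <= sigma w)%E ->
  (capped sigma T w)%:E = mine (sigma w) T%:E.
Proof.
case E: (sigma w) => [r|//|//] _; first by rewrite (capped_fin T E) EFin_min.
by rewrite (capped_infty T E) min_r ?leey.
Qed.

Lemma stopping_capped_lt sigma (T t : R) : stopping sigma -> 0 < T -> 0 < t ->
  FW W t [set w | capped sigma T w < t].
Proof.
move=> [s0 ms] T0 t0.
rewrite (_ : [set w | _] = [set w | (sigma w < t%:E)%E] `|` [set w | T < t]); last first.
  have E w : (capped sigma T w < t) = (sigma w < t%:E)%E || (T < t).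
    by rewrite -lte_fin cappedE// gt_min !lte_fin.
  by apply/seteqP; split => w /=; rewrite E => /orP.
apply: FW_setU; last first.
  have [Tt|Tt] := ltP T t.
    by rewrite (_ : [set w | _] = setT); [exact: FW_setT|apply/seteqP].
  rewrite (_ : [set w | _] = ~` setT); first (apply: FW_setC; exact: FW_setT).
  by rewrite setCT; apply/seteqP; split => w.
(* A strict inequality is a countable union of weak ones at earlier times; negative times are
   replaced by the empty set, since [stopping] says nothing about them. *)
rewrite (_ : [set w | _] = \bigcup_(n : nat)
    (if (0 <= t - n.+1%:R^-1) then [set w | (sigma w <= (t - n.+1%:R^-1)%:E)%E] else set0)).
  apply: FW_bigcup => n; case: ifPn => tn; last first.
    by rewrite -setCT; (apply: FW_setC; exact: FW_setT).
  by apply: FW_sub (ms _ tn); rewrite gerBl.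
apply/seteqP; split => w /=; last first.
  move=> [n _]; case: ifPn => //= _ /le_lt_trans; apply.
  by rewrite lte_fin gtrBl.
case E : (sigma w) => [r|//|//]; last by have := s0 w; rewrite E.
rewrite lte_fin => rt.
have r0 : 0 <= r by rewrite -lee_fin -E.
exists (Num.truncn (t - r)^-1) => //.
have h : (Num.truncn (t - r)^-1).+1%:R^-1 <= t - r.
  by rewrite invf_ple ?posrE ?subr_gt0// ltW// truncnS_gt.
move: h; move: (_.+1%:R^-1) => e h.
have -> : 0 <= t - e by lra.
by rewrite /= E lee_fin; lra.
Qed.

Lemma stopping_hit (Z : R -> Omega -> R) :
  (forall w, cts (Z ^~ w)) ->
  (forall (s : R) B, 0 <= s -> measurable B -> FW W s (Z s @^-1` B)) ->
  stopping (fun w => first_hit (Z ^~ w)).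
Proof.
move=> cZ mZ; split=> [w|t t0]; first exact: first_hit_ge0.
rewrite (_ : [set w | _] = [set w | exists2 s : R, 0 <= s <= t & Z s w <= 0]); last first.
  by apply/seteqP; split => w /=; [move=> /(first_hit_le _ (cZ w))|move=> h; apply/(first_hit_le _ (cZ w))].
have [t00|t1] := eqVneq t 0.
  rewrite (_ : [set w | _] = Z 0 @^-1` `]-oo, 0]); first by rewrite t00; exact: mZ.
  apply/seteqP; split => w /=; rewrite in_itv/=.
    move=> [s /andP[s0]]; rewrite t00 => s0'.
    by have -> : s = 0 by apply/eqP; rewrite eq_le s0' s0.
  by move=> Z0; exists 0; rewrite ?lexx.
apply: (@measurable_ex_le0 _ (g_sigma_algebraType _)) => //.
  by rewrite lt_def t1.
move=> s /andP[s0 st] _ B mB; rewrite setTI.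
by apply: FW_sub (mZ s B s0 mB); exact: ltW.
Qed.

End HittingTimes.

(** * Absorbed Brownian motion and its stopped means *)

Section AbsorbedBM.
Context {R : realType} {d : measure_display} {Omega : measurableType d}.
Local Notation cts f := {within [set t : R | 0 <= t], continuous f}.
Variables (P : probability Omega R) (W X : R -> Omega -> R) (x0 : R).
Hypothesis hW : standard_BM P W.
Hypothesis x00 : 0 < x0.
Hypothesis hX : forall (t : R) w, 0 <= t ->
  X t w = if (t%:E <= hit0 (fun s w => (x0 + W s w)%R) w)%E then x0 + W t w else 0.

Let B s w := x0 + W s w.
Let mW t : measurable_fun setT (W t). Proof. by case: hW. Qed.

Let cB w : cts (B ^~ w).
Proof.
have cW : cts (W ^~ w) by case: hW.
apply: cts_intro => s e s0 e0; have [r r0 hr] := cts_near cW s0 e0.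
exists r => // x xx0 /(hr x xx0); rewrite /B.
by have -> : x0 + W s w - (x0 + W x w) = W s w - W x w by ring.
Qed.

Let B0 w : B 0 w = x0.
Proof.
rewrite /B; have -> : W 0 w = 0 by case: hW.
by rewrite addr0.
Qed.

Let B0_gt0 w : 0 < B 0 w. Proof. by rewrite B0. Qed.

Let XE w (t : R) : 0 <= t -> X t w = if (t%:E <= first_hit (B ^~ w))%E then B t w else 0.
Proof. by move=> t0; rewrite hX// (hit0E (@cB w) (B0_gt0 w)). Qed.

Lemma X_cts w : cts (X ^~ w).
Proof. exact: (absorbed_cts (@cB w) (B0_gt0 w) (XE w)). Qed.

Lemma X_start w : X 0 w = x0.
Proof. by rewrite (absorbed0 (XE w)) B0. Qed.

Lemma X_ge0 (t : R) w : 0 <= t -> 0 <= X t w.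
Proof. exact: (absorbed_ge0 (@cB w) (B0_gt0 w) (XE w)). Qed.

Lemma X_hit0 w : hit0 X w = first_hit (X ^~ w).
Proof. by apply: hit0E; [exact: X_cts|rewrite X_start]. Qed.

Lemma X_first_hit w : first_hit (X ^~ w) = first_hit (B ^~ w).
Proof. exact: (absorbed_first_hit (@cB w) (B0_gt0 w) (XE w)). Qed.

Lemma X_before t w : 0 <= t -> (t%:E <= hit0 X w)%E -> X t w = x0 + W t w.
Proof. by move=> t0; rewrite X_hit0 X_first_hit XE// => ->. Qed.

Lemma X_after t w : (hit0 X w <= t%:E)%E -> X t w = 0.
Proof.
move=> ht; have t0 : 0 <= t.
  by rewrite -lee_fin (le_trans _ ht)// X_hit0 first_hit_ge0.
move: ht; rewrite X_hit0 X_first_hit; case E : (first_hit (B ^~ w)) => [r|//|//].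
  rewrite lee_fin (absorbed_fin (@cB w) (B0_gt0 w) (XE w) E)// => rt.
  by rewrite min_r//; have [_ ->] := first_hitP (@cB w) E (B0_gt0 w).
by have := first_hit_ge0 (B ^~ w); rewrite E.
Qed.

Let FW_B (s : R) C : 0 <= s -> measurable C -> FW W s (B s @^-1` C).
Proof.
move=> s0 mC; apply: (@gen_by_preimage _ _ _ _ _ s ((fun x => x0 + x) @^-1` C)) => /=.
  by rewrite s0 lexx.
by rewrite -[X in measurable X]setTI; apply: measurable_funD.
Qed.

Lemma stopping_hit0 : stopping W (hit0 X).
Proof.
have -> : hit0 X = fun w => first_hit (B ^~ w).
  by apply/funext => w; rewrite X_hit0 X_first_hit.
exact: stopping_hit.
Qed.

(** Before absorption [X] is [x0 + W]; afterwards [X] is [0], and the event is decided by whether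
    [0] lies in [C]. *)
Lemma FW_X t C : 0 <= t -> measurable C -> FW W t (X t @^-1` C).
Proof.
move=> t0 mC; have [_ /(_ t t0) FH] := stopping_hit0.
rewrite (_ : X t @^-1` C = ([set w | (hit0 X w <= t%:E)%E] `&` (if `[< C 0 >] then setT else set0))
   `|` (~` [set w | (hit0 X w <= t%:E)%E] `&` B t @^-1` C)).
  apply: (@measurableU _ (g_sigma_algebraType _)).
    apply: (@measurableI _ (g_sigma_algebraType _)) => //.
    by case: ifP => _; [exact: FW_setT|rewrite -setCT; (apply: FW_setC; exact: FW_setT)].
  by apply: (@measurableI _ (g_sigma_algebraType _)); [exact: FW_setC|exact: FW_B].
apply/seteqP; split => w /=.
  have [ht|ht] := leP (hit0 X w) t%:E.
    by rewrite X_after// => C0; left; split => //; rewrite asboolT.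
  by rewrite (X_before t0 (ltW ht)) => Cx; right; split => //; apply/negP; rewrite -ltNge.
move=> [[ht]|[/negP]].
  by rewrite X_after//; case: ifP => // /asboolP.
by rewrite -ltNge => /ltW ht; rewrite (X_before t0 ht).
Qed.

Lemma measurable_X t : 0 <= t -> measurable_fun setT (X t).
Proof.
by move=> t0 _ C mC; rewrite setTI; apply: (FW_measurable hW); exact: FW_X.
Qed.

Lemma gen_by_X_measurable : gen_by X [set t | 0 <= t] `<=` measurable.
Proof. by apply: gen_by_measurable => t; exact: measurable_X. Qed.

(** The strict past of [X] lies in the past of [W], so the independence of Brownian increments
    applies to strategies that observe only [X]. *)
Lemma admissible_stopping tau : admissible X tau -> stopping W tau.
Proof.
move=> [t0 mt]; split=> [w|t tge0]; first by have [] := t0 w.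
apply: gen_by_gen_by (mt t tge0) => s C /= /andP[s0 st] mC.
by apply: FW_sub (FW_X s0 mC); exact: ltW.
Qed.

Lemma capped_ge0 (sigma : Omega -> \bar R) (T : R) w : (0 <= sigma w)%E -> 0 <= T -> 0 <= capped sigma T w.
Proof. by move=> s0 T0; rewrite -lee_fin cappedE// le_min s0 lee_fin. Qed.

Lemma integral_capped sigma (T : R) : stopping W sigma -> 0 < T ->
  P.-integrable setT (fun w => (B (capped sigma T w) w)%:E) /\
  (\int[P]_w (B (capped sigma T w) w)%:E = x0%:E)%E.
Proof.
move=> st T0; have s0 := st.1.
have := @optional_stopping R d Omega P W hW T (capped sigma T) T0 _ _ _.
case => [w|w|t t0|iW EW].
- by apply: capped_ge0 => //; exact: ltW.
- by rewrite -lee_fin cappedE// ge_min lexx orbT.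
- exact: stopping_capped_lt.
have ic : P.-integrable setT (cst x0%:E : Omega -> \bar R).
  exact: finite_measure_integrable_cst.
split.
  by have := integrableD measurableT ic iW; apply: eq_integrable => // w _; rewrite /B EFinD.
under eq_integral do rewrite /B EFinD.
by rewrite integralD// EW adde0 integral_prob_cst.
Qed.

Lemma measurable_stopping_time sigma : stopping W sigma -> measurable_fun setT sigma.
Proof.
move=> [s0 ms]; apply: measurable_time => // t t0.
by apply: (FW_measurable hW); exact: ms.
Qed.

Lemma measurable_stopped_X sigma : stopping W sigma ->
  measurable_fun setT (stopped X sigma).
Proof.
move=> st; apply: measurable_stopped.
- exact: measurable_X.
- exact: X_cts.
- by apply: (measurableT_comp (fine_measurable measurableT)) => //; exact: measurable_stopping_time.
- by move=> w; apply: fine_ge0; exact: st.1.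
Qed.

Lemma stopped_ge0 sigma w : (0 <= sigma w)%E -> 0 <= stopped X sigma w.
Proof. by move=> s0; apply: X_ge0; exact: fine_ge0. Qed.

Let BX (sigma : Omega -> \bar R) (T : R) w : (0 <= sigma w)%E -> (sigma w <= hit0 X w)%E -> 0 <= T ->
  B (capped sigma T w) w = X (capped sigma T w) w.
Proof.
move=> s0 sH T0; rewrite X_before//; first exact: capped_ge0.
by rewrite cappedE// ge_min sH.
Qed.

Let capped_cvg (sigma : Omega -> \bar R) w : (0 <= sigma w)%E -> (sigma w < +oo)%E ->
  exists N : nat, forall n, (N <= n)%N -> capped sigma n.+1%:R w = fine (sigma w).
Proof.
case E : (sigma w) => [r|//|//] _ _; exists (Num.truncn r).+1 => n Nn.
rewrite (capped_fin _ E)/= min_l// ltW// (lt_le_trans (truncnS_gt r))// ler_nat.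
exact: leqW.
Qed.

(** Take [b > x0] and the horizon [b ^+ 4]. A path that is never absorbed either reaches [b] by
    then, with probability at most [x0 / b] by optional stopping at the exit from [(0, b)] and
    Markov's inequality, or is in [(0, b)] at the horizon, with probability at most [1 / b] by the
    bound on the normal density. *)
Lemma hit0_fin_ae : P [set w | hit0 X w = +oo%E] = 0%E.
Proof.
set N := [set w | _].
have mN : measurable N.
  rewrite /N -[X in measurable X]setTI.
  exact: (measurable_stopping_time stopping_hit0 measurableT (emeasurable_set1 +oo%E)).
have bound (b : R) : x0 < b -> (P N <= ((x0 + 1) / b)%:E)%E.
  move=> xb; have b0 : 0 < b := lt_trans x00 xb.
  (* The deviation at time [b ^+ 4] is [b ^+ 2], so an interval of length [b] has mass at most
     [b / b ^+ 2]. *)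
  pose T := b ^+ 4; have T0 : 0 < T by rewrite exprn_gt0.
  pose Z s w := b - B s w.
  have stb : stopping W (fun w => first_hit (Z ^~ w)).
    apply: stopping_hit => [w|s C s0 mC]; first exact: cts_subl.
    rewrite (_ : _ @^-1` _ = B s @^-1` ((fun x => b - x) @^-1` C))//.
    apply: FW_B => //; rewrite -[X in measurable X]setTI.
    by apply: measurable_funB.
  pose rho w := mine (hit0 X w) (first_hit (Z ^~ w)).
  have str : stopping W rho := stopping_min stopping_hit0 stb.
  have [iB EB] := integral_capped str T0.
  pose E1 := N `&` [set w | b <= B (capped rho T w) w].
  pose E2 := B T @^-1` `]0, b[%classic.
  have mE2 : measurable E2.
    by apply: (FW_measurable hW (t := T)); apply: FW_B => //; exact: ltW.
  have mE1 : measurable E1.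
    apply: measurableI => //.
    rewrite [X in measurable X](_ : _ = setT `&`
      (fun w => B (capped rho T w) w) @^-1` `[b, +oo[); last first.
      by rewrite setTI; apply/seteqP; split => w /=; rewrite in_itv/= andbT.
    by have /measurable_int/measurable_EFinP := iB; apply.
  have cZ w : cts (Z ^~ w) by exact: cts_subl.
  have Z0 w : 0 < Z 0 w by rewrite /Z B0 subr_gt0.
  have NE : N `<=` E1 `|` E2.
    move=> w Nw; have Bw : first_hit (B ^~ w) = +oo%E by rewrite -X_first_hit -X_hit0.
    have [zT|zT] := leP (first_hit (Z ^~ w)) T%:E; [left|right].
      split => //=; case E : (first_hit (Z ^~ w)) zT => [r|//|//]; last first.
        by have := first_hit_ge0 (Z ^~ w); rewrite E.
      rewrite lee_fin => rT.
      have rE : rho w = r%:E by rewrite /rho Nw E min_r ?leey.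
      rewrite (capped_fin T rE) min_l//.
      have [_] := first_hitP (@cZ w) E (Z0 w).
      by rewrite /Z => /eqP; rewrite subr_eq0 => /eqP ->.
    rewrite /E2 /= in_itv/= (first_hit_infty Bw (ltW T0))/=.
    rewrite ltNge; apply/negP => bT.
    have : (first_hit (Z ^~ w) <= T%:E)%E.
      apply/(first_hit_le _ (@cZ w)); exists T; first by rewrite ltW/=.
      by rewrite /Z subr_le0.
    by rewrite leNgt zT.
  have Bc0 w : 0 <= B (capped rho T w) w.
    rewrite BX ?(ltW T0)//; last by rewrite /rho ge_min lexx.
      by apply: X_ge0; apply: capped_ge0; [exact: str.1|exact: ltW].
    exact: str.1.
  have PE1 : (P E1 <= (x0 / b)%:E)%E.
    rewrite mulrC EFinM lee_pdivlMl// -EB.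
    have -> : (b%:E * P E1 = \int[P]_w (b%:E * (\1_E1 w)%:E))%E.
      rewrite ge0_integralZl_EFin//; last exact: ltW.
        by rewrite integral_indic// setIT.
      exact/measurable_EFinP/measurable_indic.
    apply: ge0_le_integral => //.
    - by move=> w _; rewrite mule_ge0// lee_fin ltW.
    - by apply: emeasurable_funM => //; exact/measurable_EFinP/measurable_indic.
    - exact: measurable_int iB.
    - move=> w _; rewrite -EFinM lee_fin indicE; case: (boolP (w \in E1)) => [/set_mem[_ /=]|_].
        by rewrite mulr1.
      by rewrite mulr0.
  have PE2 : (P E2 <= b^-1%:E)%E.
    rewrite (_ : E2 = (fun w => W T w - W 0 w) @^-1` `]- x0, b - x0[%classic); last first.
      have W0 w : W 0 w = 0 by case: hW.
      apply/seteqP; split => w; rewrite /E2 /preimage /= !in_itv/= W0 subr0 /B => /andP[? ?].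
        by apply/andP; split; lra.
      by apply/andP; split; lra.
    rewrite (increment_law hW)//.
    have sT : Num.sqrt (T - 0) = b ^+ 2.
      by rewrite subr0 /T (_ : b ^+ 4 = (b ^+ 2) ^+ 2) ?sqrtr_sqr ?ger0_norm ?sqr_ge0// -exprM.
    rewrite sT; have b20 : 0 < b ^+ 2 by rewrite exprn_gt0.
    apply: (le_trans (normal_itv_le b20 _)); first by lra.
    rewrite lee_fin (_ : b - x0 - - x0 = b); last by ring.
    rewrite -ler_pdivlMl//; apply: le_trans (normal_peak_le b20) _.
    by rewrite -invfM -expr2.
  apply: (@le_trans _ _ (P (E1 `|` E2))).
    by apply: le_measure => //; rewrite inE//; exact: measurableU.
  rewrite mulrDl mul1r EFinD.
  by apply: le_trans (leeD PE1 PE2); exact: measureU2.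
apply/eqP; rewrite eq_le measure_ge0 andbT.
apply/lee_addgt0Pr => e e0; rewrite add0e.
(* The choice [b = x0 + (x0 + 1) / e] exceeds [x0] and makes [(x0 + 1) / b] at most [e]. *)
have q0 : 0 < (x0 + 1) / e by rewrite divr_gt0// addr_gt0.
have xb : x0 < x0 + (x0 + 1) / e by rewrite ltrDl.
apply: le_trans (bound _ xb) _; rewrite lee_fin ler_pdivrMr; last exact: lt_trans xb.
by rewrite mulrDr mulrCA divff ?gt_eqF// mulr1 lerDr mulr_ge0 ?ltW.
Qed.

Let stopped_cvg (sigma : Omega -> \bar R) w : (0 <= sigma w)%E ->
  (sigma w <= hit0 X w)%E -> (sigma w < +oo)%E ->
  B (capped sigma n.+1%:R w) w @[n --> \oo] --> stopped X sigma w.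
Proof.
move=> s0 sH sfin; have [N hN] := capped_cvg s0 sfin.
apply: (cvg_near_cst); near=> n.
rewrite BX// /stopped hN//; near: n; exact: nbhs_infty_ge.
Unshelve. all: by end_near. Qed.

(** On infinite times [stopped] reads [X 0], and the capped values need not converge to it; the
    limits that follow hold off this null event. *)
Lemma stopped_fin_ae (sigma : Omega -> \bar R) :
  (forall w, (sigma w <= hit0 X w)%E) ->
  {ae P, forall w, (sigma w < +oo)%E}.
Proof.
move=> sH; exists [set w | hit0 X w = +oo%E]; split.
- rewrite -[X in measurable X]setTI.
  exact: (measurable_stopping_time stopping_hit0 measurableT (emeasurable_set1 +oo%E)).
- exact: hit0_fin_ae.
- move=> w /= /negP; rewrite -leNgt leye_eq => /eqP sw.
  by apply/eqP; rewrite -leye_eq -sw.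
Qed.

Let mBc sigma n : stopping W sigma ->
  measurable_fun setT (fun w => (B (capped sigma n.+1%:R w) w)%:E).
Proof.
by move=> st; have [/measurable_int] := integral_capped st (ltr0Sn R n).
Qed.

(** Capped times have mean [x0] exactly. An arbitrary strategy gives no bound on the path, only
    nonnegativity, so the cap is lifted by Fatou's lemma and an inequality remains. *)
Lemma integral_stopped_le sigma : admissible X sigma ->
  (\int[P]_w (stopped X sigma w)%:E <= x0%:E)%E.
Proof.
move=> adm; have st := admissible_stopping adm.
have [sH _] := adm.
pose f n w := (B (capped sigma n.+1%:R w) w)%:E.
have f0 n w : (0 <= f n w)%E.
  rewrite /f BX ?lee_fin//; [|exact: (sH w).1|exact: (sH w).2].
  by apply: X_ge0; apply: capped_ge0 => //; exact: (sH w).1.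
have := @fatou _ _ _ P setT measurableT f (fun n => mBc n st) (fun n w _ => f0 n w).
rewrite (_ : limn_einf _ = x0%:E); last first.
  rewrite (_ : (fun n => _) = cst x0%:E); last first.
    by apply/funext => n; have [_ ->] := integral_capped st (ltr0Sn R n).
  by have [-> _] := cvg_limn_einf_sup (cvg_cst x0%:E : (cst x0%:E : nat -> \bar R) @ \oo --> x0%:E).
apply: le_trans; rewrite le_eqVlt; apply/orP; left; apply/eqP.
apply: ge0_ae_eq_integral => //.
- exact/measurable_EFinP/measurable_stopped_X.
- have -> : (fun w => limn_einf (f ^~ w)) = (fun w => - limn_esup (-%E \o f ^~ w))%E.
    by apply/funext => w; rewrite limn_esupN oppeK.
  apply: measurableT_comp => //; apply: measurable_fun_limn_esup => n.
  by apply: measurableT_comp => //; exact: mBc.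
- by move=> w _; rewrite lee_fin; apply: stopped_ge0; exact: (sH w).1.
- move=> w _; rewrite limn_einf_lim; apply: lime_ge; first exact: is_cvg_einfs.
  by near=> n; apply: le_ereal_inf_tmp => _ [m _ <-].
- have := stopped_fin_ae (fun w => (sH w).2); apply: filterS => w sfin _.
  apply/esym; apply: (cvg_limn_einf_sup _).1; apply: cvg_EFin; first by near=> n.
  exact: stopped_cvg (sH w).1 (sH w).2 sfin.
Unshelve. all: by end_near. Qed.

(** A bound on the path up to [sigma] replaces Fatou's lemma by dominated convergence. Here [sigma]
    is a stopping time of [W], a class closed under minima with hitting times. *)
Lemma integral_stopped_eq sigma (C : R) : stopping W sigma ->
  (forall w, (sigma w <= hit0 X w)%E) ->
  (forall w (t : R), 0 <= t -> (t%:E <= sigma w)%E -> X t w <= C) ->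
  (\int[P]_w (stopped X sigma w)%:E = x0%:E)%E.
Proof.
move=> st sH bC; have s0 := st.1.
pose f n w := (B (capped sigma n.+1%:R w) w)%:E.
have := @dominated_convergence _ _ _ P setT measurableT f
  (fun w => (stopped X sigma w)%:E) (cst C%:E) (fun n => mBc n st).
case.
- exact/measurable_EFinP/measurable_stopped_X.
- have := stopped_fin_ae sH; apply: filterS => w sfin _.
  apply: cvg_EFin; first by near=> n.
  exact: stopped_cvg.
- exact: finite_measure_integrable_cst.
- apply: aeW => w n _; rewrite /f abse_EFin lee_fin BX//.
  rewrite ger0_norm ?X_ge0 ?capped_ge0//.
  by apply: bC; [exact: capped_ge0|rewrite cappedE// ge_min lexx].
move=> _ _; rewrite (_ : (fun n => _) = cst x0%:E); last first.
  by apply/funext => n; have [_ ->] := integral_capped st (ltr0Sn R n).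
by move=> h; have := cvg_unique _ h (cvg_cst x0%:E) => ->.
Unshelve. all: by end_near. Qed.

End AbsorbedBM.

(** * Geometric sums and a rigidity argument for survival functions *)

Section Calculus.
Context {R : realType}.

(** The quotient [(1 - u ^+ m.+1) / (1 - u)] written without its singularity at [1]; [dgeo] is its
    derivative. *)
Definition geo (m : nat) (u : R) : R := \sum_(k < m.+1) u ^+ k.
Definition dgeo (m : nat) (u : R) : R := \sum_(k < m) k.+1%:R * u ^+ k.

Lemma geoS m u : geo m.+1 u = geo m u + u ^+ m.+1.
Proof. by rewrite /geo big_ord_recr. Qed.

Lemma dgeoS m u : dgeo m.+1 u = dgeo m u + m.+1%:R * u ^+ m.
Proof. by rewrite /dgeo big_ord_recr. Qed.

Lemma geo_0 m : geo m 0 = 1.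
Proof.
elim: m => [|m IH]; first by rewrite /geo big_ord_recl big_ord0 addr0.
by rewrite geoS IH expr0n addr0.
Qed.

Lemma geo_1 m : geo m 1 = m.+1%:R.
Proof.
elim: m => [|m IH]; first by rewrite /geo big_ord_recl big_ord0 addr0.
by rewrite geoS IH expr1n natr1.
Qed.

(** This is the derivative of [geo m u * (1 - u) = 1 - u ^+ m.+1]; it supplies the factor [1 - u] in
    the equation for the survival function. *)
Lemma dgeoE m u : dgeo m u * (1 - u) = geo m u - m.+1%:R * u ^+ m.
Proof.
elim: m => [|m IH].
  by rewrite /dgeo /geo big_ord0 big_ord_recl big_ord0 mul0r addr0 expr0 mul1r subrr.
rewrite dgeoS geoS mulrDl IH -[m.+2%:R]natr1 [u ^+ m.+1]exprS.
ring.
Qed.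

Lemma dgeo_gt0 m u : 0 <= u -> 0 < dgeo m.+1 u.
Proof.
move=> u0; rewrite /dgeo big_ord_recl /= mul1r expr0 ltr_pwDl//.
by apply: sumr_ge0 => k _; rewrite mulr_ge0// exprn_ge0.
Qed.

Lemma expr_tangent (u v : R) k : 0 <= u -> u <= v ->
  k.+1%:R * u ^+ k * (v - u) <= v ^+ k.+1 - u ^+ k.+1 <= k.+1%:R * v ^+ k * (v - u).
Proof.
move=> u0 uv; have v0 := le_trans u0 uv.
elim: k => [|k /andP[IH1 IH2]]; first by rewrite !expr0 !expr1 !mul1r lexx.
have d0 : 0 <= v - u by rewrite subr_ge0.
have e : v ^+ k.+2 - u ^+ k.+2 = v * (v ^+ k.+1 - u ^+ k.+1) + u ^+ k.+1 * (v - u).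
  by rewrite [v ^+ k.+2]exprS [u ^+ k.+2]exprS; ring.
have uk : u ^+ k.+1 <= v ^+ k.+1 by rewrite lerXn2r ?nnegrE.
rewrite e; apply/andP; split.
  have -> : k.+2%:R * u ^+ k.+1 * (v - u) =
      u * (k.+1%:R * u ^+ k * (v - u)) + u ^+ k.+1 * (v - u).
    by rewrite -[k.+2%:R]natr1 [u ^+ k.+1]exprS; ring.
  rewrite lerD2r; apply: ler_pM => //.
  by rewrite !mulr_ge0 ?exprn_ge0.
have -> : k.+2%:R * v ^+ k.+1 * (v - u) =
    v * (k.+1%:R * v ^+ k * (v - u)) + v ^+ k.+1 * (v - u).
  by rewrite -[k.+2%:R]natr1 [v ^+ k.+1]exprS; ring.
by apply: lerD; [exact: ler_wpM2l|exact: ler_wpM2r].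
Qed.

Lemma geo_tangent (u v : R) m : 0 <= u -> u <= v ->
  dgeo m u * (v - u) <= geo m v - geo m u <= dgeo m v * (v - u).
Proof.
move=> u0 uv; elim: m => [|m /andP[IH1 IH2]].
  by rewrite /dgeo /geo !big_ord0 !big_ord_recl !big_ord0 !expr0 subrr !mul0r lexx.
have /andP[t1 t2] := expr_tangent m u0 uv.
rewrite !dgeoS !geoS !mulrDl.
have -> : geo m v + v ^+ m.+1 - (geo m u + u ^+ m.+1) =
  (geo m v - geo m u) + (v ^+ m.+1 - u ^+ m.+1) by ring.
by apply/andP; split; apply: lerD.
Qed.

Lemma geo_lt m (u v : R) : 0 <= u -> u < v -> geo m.+1 u < geo m.+1 v.
Proof.
move=> u0 uv; have /andP[t1 _] := geo_tangent m.+1 u0 (ltW uv).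
rewrite -subr_gt0 (lt_le_trans _ t1)// mulr_gt0 ?dgeo_gt0// subr_gt0//.
Qed.

Lemma geo_le m (u v : R) : 0 <= u -> u <= v -> geo m u <= geo m v.
Proof.
move=> u0 uv; apply: ler_sum => k _; rewrite lerXn2r ?nnegrE//.
exact: le_trans uv.
Qed.

(** Cutting [[0, b]] into [m + 1] equal pieces bounds the total change by [C * b ^+ 2 / (m + 1)]. It
    stands in for the fact that a zero derivative implies constancy, in a form that presupposes no
    derivative. *)
Lemma quadratic_osc_cst (h : R -> R) (b C : R) : 0 <= b ->
  (forall u v : R, 0 <= u -> u <= v -> v <= b -> `|h v - h u| <= C * (v - u) ^+ 2) ->
  h b = h 0.
Proof.
move=> b0 hC; apply/eqP; rewrite -subr_eq0 -normr_le0.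
have step (m k : nat) : (k <= m.+1)%N ->
    `|h (k%:R * (b / m.+1%:R)) - h 0| <= k%:R * (C * (b / m.+1%:R) ^+ 2).
  elim: k => [_|k IH km]; first by rewrite !mul0r subrr normr0.
  have q0 : 0 <= b / m.+1%:R by rewrite divr_ge0.
  have h1 := IH (ltnW km).
  have h2 : `|h (k.+1%:R * (b / m.+1%:R)) - h (k%:R * (b / m.+1%:R))| <=
      C * (b / m.+1%:R) ^+ 2.
    have -> : (b / m.+1%:R) ^+ 2 = (k.+1%:R * (b / m.+1%:R) - k%:R * (b / m.+1%:R)) ^+ 2.
      by rewrite -mulrBl -[k.+1%:R]natr1 (addrC k%:R) addrK mul1r.
    apply: hC; first by rewrite mulr_ge0.
      by rewrite ler_wpM2r// ler_nat.
    by rewrite mulrCA ler_piMr// ler_pdivrMr// mul1r ler_nat.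
  have -> : h (k.+1%:R * (b / m.+1%:R)) - h 0 =
     (h (k%:R * (b / m.+1%:R)) - h 0) +
     (h (k.+1%:R * (b / m.+1%:R)) - h (k%:R * (b / m.+1%:R))) by ring.
  rewrite -[k.+1%:R]natr1 [in leRHS]mulrDl mul1r.
  by apply: (le_trans (ler_normD _ _)); rewrite natr1 lerD.
have bound (m : nat) : `|h b - h 0| <= C * b ^+ 2 / m.+1%:R.
  have := step m m.+1 (leqnn _).
  rewrite mulrCA divff ?mulr1 ?pnatr_eq0//.
  by rewrite (_ : m.+1%:R * (C * (b / m.+1%:R) ^+ 2) = C * b ^+ 2 / m.+1%:R)//; field.
apply/ler_addgt0Pr => e e0; rewrite add0r.
have CC : C * b ^+ 2 <= `|C * b ^+ 2| by exact: ler_norm.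
apply: le_trans (bound (Num.truncn (`|C * b ^+ 2| / e))) _.
rewrite ler_pdivrMr// (le_trans CC)// [leRHS]mulrC -ler_pdivrMr//.
by rewrite ltW// truncnS_gt.
Qed.

(* The function [g] below is the survival function of a law whose barycentre
   function is known; the hypotheses bracket its increments. *)
Lemma survival_uniform (m : nat) (g : R -> R) : g 0 = 1 ->
  (forall u : R, 0 <= u <= 1 -> 0 <= g u <= 1) ->
  (forall u v : R, 0 <= u -> u < v -> v <= 1 ->
    m.+2%:R * u ^+ m.+1 * (g u - g v) <= geo m.+1 u * g u - geo m.+1 v * g v
    <= m.+2%:R * v ^+ m.+1 * (g u - g v)) ->
  forall b : R, 0 <= b < 1 -> g b = 1 - b.
Proof.
move=> g0 g01 hg b /andP[b0 b1].
(* Formally the bracket says [(geo * g)' = (m + 2) * u ^+ m.+1 * g']; with [dgeoE] this becomes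
   [g' = - g / (1 - u)], so [g / (1 - u)] should be constant. *)
pose h u := g u / (1 - u).
suff : h b = h 0.
  rewrite /h g0 subr0 divr1 => /(congr1 (fun x => x * (1 - b))).
  by rewrite divfK ?mul1r// subr_eq0 gt_eqF.
(* The estimate below ends with the denominator [(1 - v) ^+ 2 * (1 - u)], which is at least
   [(1 - b) ^+ 3]. *)
apply: (@quadratic_osc_cst _ _ ((1 - b) ^- 3)) => // u v u0 uv vb.
have [->|unv] := eqVneq u v; first by rewrite !subrr normr0 expr0n/= mulr0.
have {unv}uv' : u < v by rewrite lt_def eq_sym unv.
have v1 : v < 1 by exact: le_lt_trans b1.
have u1 : u < 1 by exact: lt_trans v1.
have v0 : 0 <= v := le_trans u0 uv.
have /andP[hA hB] := hg u v u0 uv' (ltW v1).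
have /andP[tA tB] := geo_tangent m.+1 u0 uv.
have eu := dgeoE m.+1 u; have ev := dgeoE m.+1 v.
have du := dgeo_gt0 m u0; have dv := dgeo_gt0 m v0.
have /andP[gu0 gu1] : 0 <= g u <= 1 by apply: g01; rewrite u0 ltW.
have /andP[gv0 gv1] : 0 <= g v <= 1 by apply: g01; rewrite v0 ltW.
(* The lower half of the bracket with the tangent of [geo] at [u], divided by [dgeo m.+1 u > 0]; [B]
   uses the upper half and the tangent at [v]. *)
have A : g v * (1 - u + (v - u)) <= g u * (1 - u).
  rewrite -(ler_pM2l du); have tA' := ler_wpM2r gv0 tA.
  have eu1 := congr1 (fun x => x * g u) eu.
  have eu2 := congr1 (fun x => x * g v) eu.
  by move: tA' eu1 eu2 hA => /=; lra.
have B : g u * (1 - v - (v - u)) <= g v * (1 - v).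
  rewrite -(ler_pM2l dv); have tB' := ler_wpM2r gu0 tB.
  have ev1 := congr1 (fun x => x * g u) ev.
  have ev2 := congr1 (fun x => x * g v) ev.
  by move: tB' ev1 ev2 hB => /=; lra.
pose p := 1 - v; pose q := 1 - u; pose t := 1 - b.
have p0 : 0 < p by rewrite /p; lra.
have q0 : 0 < q by rewrite /q; lra.
have t0 : 0 < t by rewrite /t; lra.
have tp : t <= p by rewrite /t /p; lra.
have pq : p <= q by rewrite /p /q; lra.
have dE : v - u = q - p by rewrite /p /q; lra.
pose E := g v * q - g u * p.
rewrite dE.
rewrite -/p -/q dE in A B.
have B' := ler_wpM2r (ltW q0) B.
have A' := ler_wpM2r (ltW q0) A.
have gd : g u * (q - p) ^+ 2 <= (q - p) ^+ 2 by rewrite ler_piMl ?sqr_ge0.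
have Eup : E * (q + (q - p)) <= (q - p) ^+ 2.
  by apply: le_trans gd; rewrite /E; move: A'; rewrite expr2; lra.
have Elo : - (q - p) ^+ 2 <= E * p.
  by rewrite lerNl; apply: le_trans gd; rewrite /E; move: B'; rewrite expr2; lra.
have Ep : `|E| * p <= (q - p) ^+ 2.
  rewrite -[X in _ * X](gtr0_norm p0) -normrM ler_norml Elo /=.
  have [E0|/ltW E0] := leP E 0.
    by apply: (@le_trans _ _ 0); rewrite ?sqr_ge0// mulr_le0_ge0// ltW.
  by apply: le_trans Eup; apply: ler_wpM2l => //; lra.
have -> : h v - h u = E / (p * q).
  by rewrite /h /E -/p -/q; field; rewrite !gt_eqF.
rewrite normrM normfV (gtr0_norm (mulr_gt0 p0 q0)).
have ppq : t ^+ 3 <= p * (p * q).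
  rewrite !exprS expr0 mulr1; apply: ler_pM; rewrite ?(ltW t0)//.
    by rewrite mulr_ge0// ltW.
  by apply: ler_pM; rewrite ?(ltW t0)//; exact: le_trans pq.
rewrite ler_pdivrMr ?mulr_gt0// -(ler_pM2r p0); apply: le_trans Ep _.
rewrite -/t (_ : t ^- 3 * (q - p) ^+ 2 * (p * q) * p =
  (q - p) ^+ 2 * (p * (p * q) / t ^+ 3)); last by ring.
by rewrite ler_peMr ?sqr_ge0// ler_pdivlMr ?mul1r// exprn_gt0.
Qed.

End Calculus.

(** * The equilibrium law and its barycentre *)

Section Law.
Context {R : realType}.
Local Notation cts f := {within [set t : R | 0 <= t], continuous f}.
Variables (m : nat) (x0 : R).
Hypothesis x00 : 0 < x0.
Local Notation n := m.+2.
Local Notation F := (Flaw n x0).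
Let c := n%:R * x0.
Let c0 : 0 < c. Proof. by rewrite mulr_gt0. Qed.

Lemma Flaw_ge0 x : 0 <= F x.
Proof. by rewrite /Flaw; case: ifP => // _; rewrite le_min powR_ge0 ler01. Qed.

Lemma Flaw_le1 x : F x <= 1.
Proof. by rewrite /Flaw; case: ifP => // _; rewrite ge_min lexx orbT. Qed.

Lemma Flaw_homo x y : x <= y -> F x <= F y.
Proof.
move=> xy; rewrite {1}/Flaw; case: ltP => xx0; first exact: Flaw_ge0.
have yy0 : 0 <= y := le_trans xx0 xy.
rewrite /Flaw ltNge yy0 /= le_min !ge_min lexx orbT andbT.
apply/orP; left; apply: ge0_ler_powR; rewrite ?nnegrE ?divr_ge0 ?(ltW c0)//.
by rewrite ler_pM2r ?invr_gt0.
Qed.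

(** The power [m.+1] is the number of rivals: the largest of that many independent values with law
    [F] is uniform on [[0, c]]. *)
Lemma Flaw_exp x : 0 <= x -> F x ^+ m.+1 = Num.min (x / c) 1.
Proof.
move=> xx0; rewrite /Flaw ltNge xx0 /=.
have q0 : 0 <= x / c by rewrite divr_ge0// ltW.
have e : (powR (x / c) m.+1%:R^-1) ^+ m.+1 = x / c.
  by rewrite -powR_mulrn ?powR_ge0// -powRrM mulVf ?pnatr_eq0// powRr1.
have [le1|gt1] := leP (powR (x / c) m.+1%:R^-1) 1.
  rewrite e min_l//.
  by rewrite -e exprn_ile1// powR_ge0.
by rewrite expr1n min_r// -e exprn_ege1// ltW.
Qed.

Lemma Flaw_inv x : 0 <= x <= c -> x = c * F x ^+ m.+1.
Proof.
move=> /andP[xx0 xc]; rewrite Flaw_exp// min_l; last by rewrite ler_pdivrMr// mul1r.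
by rewrite mulrC divfK// gt_eqF.
Qed.

Lemma Flaw0 : F 0 = 0.
Proof. by rewrite /Flaw ltxx mul0r powR0 ?invr_eq0 ?pnatr_eq0// min_l. Qed.

Lemma Flaw_x0_gt0 : 0 < F x0.
Proof.
rewrite /Flaw (lt_gtF x00) lt_min ltr01 andbT powR_gt0//.
by rewrite divr_gt0.
Qed.

Lemma exprD_superadd (x y : R) k : 0 <= x -> 0 <= y ->
  x ^+ k.+1 + y ^+ k.+1 <= (x + y) ^+ k.+1.
Proof.
move=> xx0 y0; elim: k => [|k IH]; first by rewrite !expr1.
rewrite [(x + y) ^+ _]exprS; apply: le_trans (ler_wpM2l (addr_ge0 xx0 y0) IH).
have : 0 <= x * y ^+ k.+1 by rewrite mulr_ge0 ?exprn_ge0.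
have : 0 <= y * x ^+ k.+1 by rewrite mulr_ge0 ?exprn_ge0.
by rewrite [x ^+ k.+2]exprS [y ^+ k.+2]exprS; lra.
Qed.

(** Superadditivity of the power gives [(F b - F a) ^+ m.+1 <= F b ^+ m.+1 - F a ^+ m.+1], a
    difference of truncated linear functions. The root may have infinite slope at [0], so continuity
    of [F] along a path is drawn from this bound. *)
Lemma Flaw_hoelder a b : 0 <= a -> a <= b -> (F b - F a) ^+ m.+1 <= (b - a) / c.
Proof.
move=> a0 ab; have b0 := le_trans a0 ab.
have d0 : 0 <= F b - F a by rewrite subr_ge0 Flaw_homo.
have := exprD_superadd m d0 (Flaw_ge0 a); rewrite subrK !Flaw_exp// => h.
have : Num.min (b / c) 1 - Num.min (a / c) 1 <= (b - a) / c.
  rewrite mulrBl.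
  have ac : a / c <= b / c by rewrite ler_pM2r// invr_gt0.
  have [|] := leP (a / c) 1; have [|] := leP (b / c) 1; lra.
by lra.
Qed.

Lemma Flaw_cts (f : R -> R) : cts f -> (forall t, 0 <= t -> 0 <= f t) ->
  cts (fun t => F (f t)).
Proof.
move=> cf f0; apply: cts_intro => s e s0 e0.
have ce0 : 0 < c * e ^+ m.+1 by rewrite mulr_gt0// exprn_gt0.
have [r r0 hr] := cts_near cf s0 ce0; exists r => // x xx0 /(hr x xx0) h.
have key a b : 0 <= a -> a <= b -> `|b - a| < c * e ^+ m.+1 -> `|F b - F a| < e.
  move=> a0 ab; rewrite !ger0_norm ?subr_ge0 ?Flaw_homo// => abe.
  rewrite -(@ltr_pXn2r _ m.+1) ?nnegrE ?subr_ge0 ?Flaw_homo ?(ltW e0)//.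
  by apply: (le_lt_trans (Flaw_hoelder a0 ab)); rewrite ltr_pdivrMr// mulrC.
have [sx|/ltW xs] := leP (f s) (f x).
  by rewrite distrC; apply: key; rewrite ?f0// distrC.
by apply: key; rewrite ?f0.
Qed.

Lemma measurable_Flaw : measurable_fun setT F.
Proof. by apply: nondecreasing_measurable => // x y; exact: Flaw_homo. Qed.

Lemma continuous_geo k : continuous (geo k : R -> R).
Proof.
elim: k => [|k IH].
  have -> : geo 0 = cst 1 :> (R -> R).
    by apply/funext => u; rewrite /geo big_ord_recl big_ord0 addr0 expr0.
  by move=> x; exact: cvg_cst.
have -> : geo k.+1 = (fun u => geo k u + u ^+ k.+1) :> (R -> R).
  by apply/funext => u; rewrite geoS.
by move=> x; apply: cvgD; [exact: IH|exact: exprn_continuous].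
Qed.

(* [E(Y | Y >= x) = x0 * (1 - F x ^+ m.+2) / (1 - F x)] for [Y] with law [F]. *)
Definition bary x := x0 * geo m.+1 (F x).

Lemma measurable_bary : measurable_fun setT bary.
Proof.
apply: measurable_funM => //.
apply: (measurableT_comp _ measurable_Flaw).
by apply: continuous_measurable_fun; exact: continuous_geo.
Qed.

Lemma bary_cts (f : R -> R) : cts f -> (forall t, 0 <= t -> 0 <= f t) ->
  cts (fun t => bary (f t)).
Proof.
move=> cf f0.
apply: (@within_continuous_comp R R R [set t : R | 0 <= t] (fun t => F (f t))
  (fun u => x0 * geo m.+1 u)).
  by move=> u _; apply: cvgM; [exact: cvg_cst|exact: continuous_geo].
exact: Flaw_cts.
Qed.

Lemma bary_le x : bary x <= c.
Proof.
by rewrite /bary /c mulrC ler_pM2r// -geo_1 geo_le ?Flaw_ge0 ?Flaw_le1.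
Qed.

Lemma bary0 : bary 0 = x0.
Proof. by rewrite /bary Flaw0 geo_0 mulr1. Qed.

Lemma bary_x0 : x0 < bary x0.
Proof.
by rewrite /bary ltr_pMr// -(geo_0 m.+1) geo_lt// Flaw_x0_gt0.
Qed.

(** Since [geo m.+1] is strictly increasing on nonnegative arguments, a threshold for the barycentre
    is a threshold for [F]. *)
Lemma bary_ge (u x : R) : 0 <= u ->
  (x0 * geo m.+1 u <= bary x) = (u <= F x).
Proof.
move=> u0; rewrite /bary ler_pM2l//; have [uF|Fu] := leP u (F x).
  by rewrite geo_le.
by apply/negbTE; rewrite -ltNge geo_lt// Flaw_ge0.
Qed.

End Law.

Lemma cts_sub {R : realType} (f g : R -> R) :
  {within [set t : R | 0 <= t], continuous f} ->
  {within [set t : R | 0 <= t], continuous g} ->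
  {within [set t : R | 0 <= t], continuous (fun t => f t - g t)}.
Proof.
move=> cf cg; apply: cts_intro => s e s0 e0; have e20 : 0 < e / 2 by lra.
have [r r0 hr] := cts_near cf s0 e20; have [q q0 hq] := cts_near cg s0 e20.
exists (Num.min r q); first by rewrite lt_min r0.
move=> x x0; rewrite lt_min => /andP[/(hr x x0) + /(hq x x0)].
rewrite !ltr_norml => /andP[? ?] /andP[? ?]; apply/andP; split; lra.
Qed.

(** * The Azema-Yor embedding of the law *)

Section AzemaYor.
Context {R : realType} {d : measure_display} {Omega : measurableType d}.
Local Notation cts f := {within [set t : R | 0 <= t], continuous f}.
Variables (P : probability Omega R) (W X : R -> Omega -> R) (x0 : R) (m : nat).
Hypothesis hW : standard_BM P W.
Hypothesis x00 : 0 < x0.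
Hypothesis hX : forall (t : R) w, 0 <= t ->
  X t w = if (t%:E <= hit0 (fun s w => (x0 + W s w)%R) w)%E then x0 + W t w else 0.
Local Notation n := m.+2.
Local Notation F := (Flaw n x0).
Local Notation Psi := (bary m x0).
Let c := n%:R * x0.

Let Xc w : cts (X ^~ w). Proof. exact: (X_cts hW x00 hX). Qed.
Let X0 w : X 0 w = x0. Proof. exact: (X_start hW x00 hX). Qed.
Let Xge0 (t : R) w : 0 <= t -> 0 <= X t w. Proof. exact: (X_ge0 hW x00 hX). Qed.

(** Positive at time [0] and zero at its first hit, so that at a finite [AY_time] the running
    maximum equals the barycentre of the current value. *)
Let Z t w := Psi (X t w) - runmax (X ^~ w) t.

Definition AY_time w : \bar R := first_hit (Z ^~ w).

Let Zc w : cts (Z ^~ w).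
Proof.
apply: cts_sub; last exact: cts_runmax.
by apply: bary_cts => // t; exact: Xge0.
Qed.

Let Z0 w : 0 < Z 0 w.
Proof. by rewrite /Z runmax0// X0 subr_gt0 bary_x0. Qed.

(** When [X] is at [0] the barycentre takes its least value [x0], which the running maximum has
    reached from the start. *)
Lemma AY_le_hit0 w : (AY_time w <= hit0 X w)%E.
Proof.
rewrite (X_hit0 hW x00 hX); apply: le_ereal_inf => _ [t [t0 Xt] <-].
exists t => //; split => //.
have -> : Z t w = x0 - runmax (X ^~ w) t.
  by rewrite /Z (_ : X t w = 0) ?bary0//; apply/eqP; rewrite eq_le Xt Xge0.
by rewrite subr_le0 -(X0 w) le_runmax.
Qed.

Let mZ d' (T : measurableType d') (Y : R -> T -> R) s :
  (forall w, cts (Y ^~ w)) -> 0 <= s ->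
  (forall r : R, 0 <= r <= s -> measurable_fun setT (Y r)) ->
  measurable_fun setT (fun w => Psi (Y s w) - runmax (Y ^~ w) s).
Proof.
move=> cY s0 mY; apply: measurable_funB; last exact: measurable_runmax.
apply: (measurableT_comp (measurable_bary m x00)).
by apply: mY; rewrite s0 lexx.
Qed.

Lemma AY_admissible : admissible X AY_time.
Proof.
split=> [w|t t0]; first by split; [exact: first_hit_ge0|exact: AY_le_hit0].
rewrite (_ : [set w | _] = [set w | exists2 s : R, 0 <= s <= t & Z s w <= 0]); last first.
  by apply/seteqP; split => w /=; [move=> /(first_hit_le _ (@Zc w))|move=> h; apply/(first_hit_le _ (@Zc w))].
(* The strict past at time [0] is trivial; the event is empty there because [Z 0] is positive. *)
have [t00|t1] := eqVneq t 0.
  rewrite (_ : [set w | _] = set0); first exact: (@measurable0 _ (g_sigma_algebraType _)).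
  apply/seteqP; split => // w [s /andP[s0]]; rewrite t00 => s0'.
  have -> : s = 0 by apply/eqP; rewrite eq_le s0' s0.
  by rewrite leNgt Z0.
apply: (@measurable_ex_le0 _ _ (g_sigma_algebraType _)) => //.
  by rewrite lt_def t1.
move=> s /andP[s0 st].
apply: (@mZ _ (g_sigma_algebraType _) X s) => // r /andP[r0 rs] _ C mC.
rewrite setTI; apply: gen_by_preimage => //=.
by rewrite r0 (le_lt_trans rs).
Qed.

Let AY_stopping : stopping W AY_time.
Proof. exact: (admissible_stopping hW x00 hX AY_admissible). Qed.

(** Up to [AY_time] the running maximum does not exceed the barycentre, whose values are at most
    [c]; this is the bound that [integral_stopped_eq] asks for. *)
Let X_le_c w (t : R) : 0 <= t -> (t%:E <= AY_time w)%E -> X t w <= c.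
Proof.
move=> t0 tt; apply: (le_trans (le_runmax (@Xc w) t0 (lexx t))).
apply: le_trans (bary_le m x00 (X t w)); rewrite -subr_ge0 -/(Z t w).
move: tt; rewrite /AY_time; case E : (first_hit (Z ^~ w)) => [r|//|//].
  rewrite lee_fin le_eqVlt => /predU1P[->|tr].
    by have [_ ->] := first_hitP (@Zc w) E (Z0 w).
  exact/ltW/(first_hit_gt0 (@Zc w) E).
by move=> _; exact/ltW/(first_hit_infty E).
Qed.

Let S := stopped X AY_time.
Let U w := F (S w).

Let S_itv w : 0 <= S w <= c.
Proof.
have t0 := first_hit_ge0 (Z ^~ w).
rewrite /S /stopped Xge0 ?fine_ge0//=; apply: X_le_c; first exact: fine_ge0.
by rewrite /AY_time; case: (first_hit _) t0.
Qed.

Let mS : measurable_fun setT S.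
Proof. exact: (measurable_stopped_X hW x00 hX AY_stopping). Qed.

Let iS : P.-integrable setT (EFin \o S).
Proof.
apply: (@le_integrable _ _ _ P setT measurableT (EFin \o S) (cst c%:E)).
- exact/measurable_EFinP.
- move=> w _ /=; rewrite lee_fin; have /andP[S0 Sc] := S_itv w.
  by rewrite !ger0_norm// (le_trans S0).
- exact: finite_measure_integrable_cst.
Qed.

Let mA u : measurable [set w | u <= U w].
Proof.
have mU : measurable_fun setT U.
  exact: (measurableT_comp (measurable_Flaw m x00) mS).
rewrite [X in measurable X](_ : _ = setT `&` U @^-1` `[u, +oo[); first exact: mU.
by rewrite setTI; apply/seteqP; split => w /=; rewrite in_itv/= andbT.
Qed.

Let ES : (\int[P]_w (S w)%:E = x0%:E)%E.
Proof.
exact: (integral_stopped_eq hW x00 hX AY_stopping AY_le_hit0 (C := c) X_le_c).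
Qed.

(* Compare the stopping times [AY_time] and [AY_time] capped at the hitting
   time of the level [a = x0 * geo u]: they differ exactly on [u <= U]. *)
Lemma AY_barycentre (u : R) : 0 <= u ->
  (\int[P]_(w in [set w | (u <= U w)%R]) (S w)%:E =
   (x0 * geo m.+1 u)%:E * P [set w | (u <= U w)%R])%E.
Proof.
rewrite le_eqVlt => /predU1P[<-|u0].
  rewrite (_ : [set w | _] = setT); last first.
    by apply/seteqP; split => // w _ /=; exact: Flaw_ge0.
  by rewrite ES geo_0 mulr1 probability_setT mule1.
set A := [set w | u <= U w]; set a := x0 * geo m.+1 u.
have xa : x0 < a by rewrite /a ltr_pMr// -(geo_0 m.+1) geo_lt.
pose Za t w := a - X t w.
have cZa w : cts (Za ^~ w) by exact: cts_subl.
have Za0 w : 0 < Za 0 w by rewrite /Za X0 subr_gt0.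
have st_a : stopping W (fun w => first_hit (Za ^~ w)).
  apply: stopping_hit => // s C s0 mC.
  rewrite (_ : _ @^-1` _ = X s @^-1` ((fun x => a - x) @^-1` C))//.
  apply: (FW_X hW x00 hX) => //; rewrite -[X in measurable X]setTI.
  by apply: measurable_funB.
pose sg w := mine (AY_time w) (first_hit (Za ^~ w)).
have st_sg : stopping W sg := stopping_min AY_stopping st_a.
have sg_hit w : (sg w <= hit0 X w)%E.
  by rewrite /sg ge_min AY_le_hit0.
have Esg : (\int[P]_w (stopped X sg w)%:E = x0%:E)%E.
  apply: (integral_stopped_eq hW x00 hX st_sg sg_hit (C := c)) => w t t0 ts.
  by apply: X_le_c => //; apply: (le_trans ts); rewrite /sg ge_min lexx.
have mAu : measurable A := mA u.
have mAc : measurable (~` A) by exact: measurableC.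
(* At a finite [AY_time] the running maximum is [Psi (S w)], so by [bary_ge] the level [a] has been
   reached exactly when [u <= U w]; then [sg] stops at [a], otherwise at [AY_time]. *)
have sgE w : (AY_time w < +oo)%E -> stopped X sg w = if u <= U w then a else S w.
  rewrite /U /S /stopped /AY_time; case E : (first_hit (Z ^~ w)) => [r|//|//] _ /=.
    have [r0 Zr] := first_hitP (@Zc w) E (Z0 w).
    have MP : runmax (X ^~ w) r = Psi (X r w).
      by apply/eqP; rewrite eq_sym -subr_eq0 -/(Z r w) Zr.
    rewrite -(bary_ge m x00 _ (ltW u0)) -MP -/a.
    case: ifPn => [aM|aM].
      have [s /andP[s0 sr] Xs] := (runmax_ge a (@Xc w) (ltW r0)).1 aM.
      have ha : (first_hit (Za ^~ w) <= r%:E)%E.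
        by apply/(first_hit_le _ (@cZa w)); exists s => //; rewrite s0.
      have : sg w = first_hit (Za ^~ w) by rewrite /sg /AY_time E min_r.
      case E2 : (first_hit (Za ^~ w)) ha => [h|//|//] _ ->; last first.
        by have := first_hit_ge0 (Za ^~ w); rewrite E2.
      have [_] := first_hitP (@cZa w) E2 (Za0 w).
      by rewrite /Za /= => /eqP; rewrite subr_eq0 => /eqP <-.
    suff -> : sg w = r%:E by [].
    rewrite /sg /AY_time E min_l// leNgt; apply/negP => ha.
    move/negP: aM; apply; apply/(runmax_ge a (@Xc w) (ltW r0)).
    exact/(first_hit_le _ (@cZa w))/ltW.
  by have := first_hit_ge0 (Z ^~ w); rewrite E.
have fin_ae := stopped_fin_ae hW x00 hX AY_le_hit0.
have S0 w : (0 <= (S w)%:E)%E by rewrite lee_fin; have /andP[] := S_itv w.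
have a0 : 0 <= a by rewrite ltW// (lt_trans x00).
have sg0 w : (0 <= (stopped X sg w)%:E)%E.
  by rewrite lee_fin (stopped_ge0 hW x00 hX)//; exact: st_sg.1.
have msg : measurable_fun setT (fun w => (stopped X sg w)%:E).
  exact/measurable_EFinP/(measurable_stopped_X hW x00 hX st_sg).
have mSE : measurable_fun setT (fun w => (S w)%:E) by exact/measurable_EFinP.
have dA : [disjoint A & ~` A] by apply/disj_setPCl.
have e1 : (\int[P]_(w in A) (S w)%:E + \int[P]_(w in ~` A) (S w)%:E = x0%:E)%E.
  by rewrite -ge0_integral_setU ?setUv.
(* Stopping at [sg] or at [AY_time] gives the same mean [x0], and almost surely the same value off
   [A], so the two integrals over [A] coincide. *)
have e2 : (a%:E * P A + \int[P]_(w in ~` A) (S w)%:E = x0%:E)%E.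
  rewrite -Esg -[in RHS](setUv A) ge0_integral_setU ?setUv//; congr (_ + _)%E.
    rewrite -integral_cst//; apply: ge0_ae_eq_integral => //.
    - exact: measurable_funTS.
    - have := fin_ae; apply: filterS => w fin Aw /=.
      by rewrite sgE// ifT.
  apply: ge0_ae_eq_integral => //.
  - exact: measurable_funTS.
  - exact: measurable_funTS.
  - have := fin_ae; apply: filterS => w fin Aw /=.
    by rewrite sgE//; case: ifPn => // uU; exfalso; apply: Aw.
have fin : (\int[P]_(w in ~` A) (S w)%:E)%E \is a fin_num.
  by apply: integrable_fin_num => //; exact: integrableS iS.
by rewrite -(addeK (\int[P]_(w in A) (S w)%:E)%E fin) e1 -e2 addeK.
Qed.

Let g u := fine (P [set w | u <= U w]).

Let gE u : P [set w | u <= U w] = (g u)%:E.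
Proof. by rewrite fineK// fin_num_measure. Qed.

(** On [u <= U < v] the value [S = c * U ^+ m.+1] lies between [c * u ^+ m.+1] and [c * v ^+ m.+1],
    while its integral there is the difference of two instances of [AY_barycentre]. Dividing by [x0]
    leaves the factor [m.+2]. *)
Let g_bracket u v : 0 <= u -> u < v -> v <= 1 ->
  m.+2%:R * u ^+ m.+1 * (g u - g v) <= geo m.+1 u * g u - geo m.+1 v * g v
  <= m.+2%:R * v ^+ m.+1 * (g u - g v).
Proof.
move=> u0 uv v1; have v0 : 0 <= v by rewrite ltW// (le_lt_trans u0).
pose A u := [set w | u <= U w]; pose D := A u `\` A v.
have gA t : P (A t) = (g t)%:E by exact: gE.
have bA t : 0 <= t ->
    (\int[P]_(w in A t) (S w)%:E = (x0 * geo m.+1 t)%:E * P (A t))%E.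
  exact: AY_barycentre.
have mD : measurable D by apply: measurableD; exact: mA.
have AE : A u = A v `|` D.
  rewrite /D setDE setUIr setUv setIT; apply/esym/setUidPr => w /=.
  exact/le_trans/ltW.
have dAD : [disjoint A v & D] by apply/disj_setPS => w [Av [_ nAv]].
have S0 w : (0 <= (S w)%:E)%E by rewrite lee_fin; have /andP[] := S_itv w.
have mSE : measurable_fun setT (fun w => (S w)%:E) by exact/measurable_EFinP.
have PD : P D = (g u - g v)%:E.
  have e : (P (A u) = P (A v) + P D)%E.
    rewrite AE measureU//; first exact: mA.
    by apply/seteqP; split => // w [Av [_ nAv]].
  move: e; rewrite !gA; have : P D \is a fin_num by rewrite fin_num_measure.
  by case: (P D) => // r _; rewrite -EFinD => -[->]; rewrite addrAC subrr add0r.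
have ID : (\int[P]_(w in D) (S w)%:E =
    (x0 * (geo m.+1 u * g u - geo m.+1 v * g v))%:E)%E.
  have := bA u u0; rewrite gA AE ge0_integral_setU//; last 2 first.
  - exact: mA.
  - exact: measurable_funTS.
  rewrite bA// gA -!EFinM.
  have : (\int[P]_(w in D) (S w)%:E)%E \is a fin_num.
    by apply: integrable_fin_num => //; exact: integrableS iS.
  case: (\int[P]_(w in D) (S w)%:E)%E => // r _; rewrite -EFinD => -[h].
  by congr EFin; lra.
have SU w : S w = c * U w ^+ m.+1 by exact: Flaw_inv.
have c0 : 0 < c by rewrite mulr_gt0.
have lo : ((c * u ^+ m.+1)%:E * P D <= \int[P]_(w in D) (S w)%:E)%E.
  rewrite -integral_cst//; apply: ge0_le_integral => //.
  - by move=> w _; rewrite lee_fin mulr_ge0 ?exprn_ge0// ltW.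
  - exact: measurable_funTS.
  - move=> w [uU _]; rewrite lee_fin SU ler_pM2l// lerXn2r ?nnegrE//.
    exact: Flaw_ge0.
have up : (\int[P]_(w in D) (S w)%:E <= (c * v ^+ m.+1)%:E * P D)%E.
  rewrite -integral_cst//; apply: ge0_le_integral => //.
  - exact: measurable_funTS.
  - move=> w [_ /negP]; rewrite -ltNge => Uv.
    rewrite lee_fin SU ler_pM2l// lerXn2r ?nnegrE ?(ltW Uv)//.
    exact: Flaw_ge0.
move: lo up; rewrite ID PD -!EFinM !lee_fin /c => lo up.
apply/andP; split; rewrite -(ler_pM2l x00).
  by apply: le_trans lo; rewrite le_eqVlt; apply/orP; left; apply/eqP; ring.
by apply: (le_trans up); rewrite le_eqVlt; apply/orP; left; apply/eqP; ring.
Qed.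

Lemma AY_uniform (b : R) : 0 <= b < 1 -> P [set w | b <= U w] = (1 - b)%:E.
Proof.
move=> b01; rewrite gE; congr EFin; apply: (@survival_uniform _ m) b01.
- apply: EFin_inj; rewrite -gE (_ : [set w | _] = setT) ?probability_setT//.
  by apply/seteqP; split => // w _ /=; exact: Flaw_ge0.
- by move=> u _; rewrite -!lee_fin -gE measure_ge0 probability_le1.
- exact: g_bracket.
Qed.

Lemma AY_law : has_law P X AY_time F.
Proof.
move=> x; rewrite -/S.
have [xx0|xx0] := ltP x 0.
  rewrite (_ : [set w | _] = set0) ?measure0 /Flaw ?xx0//.
  apply/seteqP; split => // w /=; rewrite leNgt => /negP; apply.
  by apply: (lt_le_trans xx0); have /andP[] := S_itv w.
have c0 : 0 < c by rewrite mulr_gt0.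
have [cx|xc] := leP c x.
  rewrite (_ : [set w | _] = setT); last first.
    apply/seteqP; split => // w _ /=; apply: le_trans cx.
    by have /andP[] := S_itv w.
  rewrite probability_setT /Flaw ltNge xx0 /= min_r//.
  have p1 : powR 1 m.+1%:R^-1 = 1 :> R by rewrite powR1.
  rewrite -[leLHS]p1; apply: ge0_ler_powR; rewrite ?nnegrE//.
    by rewrite divr_ge0// ltW.
  by rewrite ler_pdivlMr// mul1r.
have xE : x = c * F x ^+ m.+1 by apply: Flaw_inv => //; rewrite xx0 ltW.
have Fx0 : 0 <= F x := Flaw_ge0 m x0 x.
have Fx1 : F x < 1.
  rewrite ltNge; apply/negP => F1; move: xc; rewrite xE ltNge => /negP; apply.
  by rewrite ler_peMr ?(ltW c0)// exprn_ege1.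
have SE w : (S w <= x) = (U w <= F x).
  have SU : S w = c * U w ^+ m.+1 by exact: Flaw_inv.
  by rewrite {1}SU {1}xE ler_pM2l// ler_pXn2r ?nnegrE//; exact: Flaw_ge0.
have mS' : measurable [set w | S w <= x].
  rewrite [X in measurable X](_ : _ = setT `&` S @^-1` `]-oo, x]); first exact: mS.
  by rewrite setTI; apply/seteqP; split => w /=; rewrite in_itv.
have CE : P (~` [set w | S w <= x]) = (1 - F x)%:E.
  apply/eqP; rewrite eq_le; apply/andP; split.
    rewrite -AY_uniform ?Fx0//; apply: le_measure; rewrite ?inE//.
    - exact: measurableC.
    - by move=> w /= /negP; rewrite SE -ltNge => /ltW.
  apply/lee_subgt0Pr => e e0.
  (* [AY_uniform] treats weak inequalities at levels below [1]; a level just above [F x], kept below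
     [1] by the midpoint, handles the strict inequality. *)
  pose v := Num.min (F x + e) ((F x + 1) / 2).
  have v1 : v < 1 by rewrite /v gt_min; apply/orP; right; lra.
  have Fv : F x < v by rewrite /v lt_min; apply/andP; split; lra.
  have v01 : 0 <= v < 1 by rewrite v1 andbT ltW// (le_lt_trans Fx0).
  apply: (@le_trans _ _ (P [set w | v <= U w])).
    rewrite AY_uniform// -EFinB lee_fin.
    have : v <= F x + e by rewrite /v ge_min lexx.
    lra.
  apply: le_measure; rewrite ?inE//; first exact: measurableC.
  by move=> w /= vU; apply/negP; rewrite SE -ltNge (lt_le_trans Fv).
have := probability_setC P mS'; rewrite CE.
have : P [set w | S w <= x] \is a fin_num by rewrite fin_num_measure.
case: (P [set w | S w <= x]) => // r _; rewrite -EFinB => -[h].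
by congr EFin; lra.
Qed.

End AzemaYor.

(** * Observables determined by one player's path *)

Section GeneratedMeasurability.
Context {R : realType} {d : measure_display} {Omega : measurableType d}.
Local Notation cts f := {within [set t : R | 0 <= t], continuous f}.
Variable X : R -> Omega -> R.
Hypothesis Xc : forall w, cts (X ^~ w).
Let G := [set A | exists s B, [set t : R | 0 <= t] s /\ measurable B /\ A = X s @^-1` B].

Let mX (t : R) : 0 <= t ->
  measurable_fun [set: g_sigma_algebraType G] (X t : g_sigma_algebraType G -> R).
Proof. by move=> t0; exact: gen_by_measurable_fun. Qed.

(** Placing the event in the sigma-algebra of a single player's path is what lets the independence
    of the players be applied to it. *)
Lemma stopped_gen tau (C : set R) : admissible X tau -> measurable C ->
  gen_by X [set t | 0 <= t] (stopped X tau @^-1` C).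
Proof.
move=> [t0 mt] mC.
have mtau : measurable_fun [set: g_sigma_algebraType G]
    (tau : g_sigma_algebraType G -> \bar R).
  apply: measurable_time => [w|t tge0]; first by have [] := t0 w.
  by apply: gen_by_sub (mt t tge0) => s /= /andP[].
have h : measurable_fun [set: g_sigma_algebraType G]
    (fun w : g_sigma_algebraType G => X ((fine \o tau) w) w).
  apply: measurable_stopped => //.
  - exact: (measurableT_comp (fine_measurable measurableT) mtau).
  - by move=> w /=; apply: fine_ge0; have [] := t0 w.
by have := h measurableT C mC; rewrite setTI.
Qed.

Hypothesis X_ge0 : forall (t : R) w, 0 <= t -> 0 <= X t w.
Hypothesis X_after : forall (t : R) w, (hit0 X w <= t%:E)%E -> X t w = 0.
Hypothesis hit0_ge0 : forall w, (0 <= hit0 X w)%E.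

(** Integer horizons turn the supremum over all times into a countable one; after absorption the
    path is [0], no greater than its starting value, so nothing is added. *)
Lemma run_maxE w :
  run_max X w = esups (fun k => (runmax (X ^~ w) k%:R)%:E) 0.
Proof.
apply/eqP; rewrite eq_le; apply/andP; split.
  apply: ge_ereal_sup => _ [t [t0 _] <-].
  apply: (@le_trans _ _ (runmax (X ^~ w) (Num.truncn t).+1%:R)%:E).
    by rewrite lee_fin le_runmax// ltW// truncnS_gt.
  by apply: ereal_sup_ubound; exists (Num.truncn t).+1.
apply: ge_ereal_sup => _ [k _ <-].
have [c /andP[c0 ck] [-> _]] := runmaxP (@Xc w) (ler0n R k).
have [cH|Hc] := leP c%:E (hit0 X w).
  by apply: ereal_sup_ubound; exists c.
rewrite (X_after (ltW Hc)); apply: (@le_trans _ _ (X 0 w)%:E).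
  by rewrite lee_fin X_ge0.
by apply: ereal_sup_ubound; exists 0.
Qed.

Lemma run_max_gen (C : set (\bar R)) : measurable C ->
  gen_by X [set t | 0 <= t] (run_max X @^-1` C).
Proof.
move=> mC; have h : measurable_fun [set: g_sigma_algebraType G]
    (run_max X : g_sigma_algebraType G -> \bar R).
  have -> : run_max X = fun w => esups (fun k => (runmax (X ^~ w) k%:R)%:E) 0.
    by apply/funext => w; exact: run_maxE.
  apply: (@measurable_fun_esups _ (g_sigma_algebraType G) R setT
    (fun k w => (runmax (X ^~ w) k%:R)%:E)) => k.
  apply/measurable_EFinP/measurable_runmax => //.
  by move=> s /andP[s0 _]; exact: mX.
by have := h measurableT C mC; rewrite setTI.
Qed.

Lemma stopped_le_run_max tau w : (0 <= tau w)%E -> (tau w <= hit0 X w)%E ->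
  ((stopped X tau w)%:E <= run_max X w)%E.
Proof.
move=> t0 tH; apply: ereal_sup_ubound; exists (fine (tau w)) => //=.
split; first exact: fine_ge0.
by move: tH t0; case: (tau w) => //.
Qed.

End GeneratedMeasurability.

(** * Pointwise bounds and measurability of the payoff *)

Section Payoff.
Context {R : realType}.
Variables (m : nat) (K K2 : R) (i : 'I_m.+2).
Implicit Types (Y : 'I_m.+2 -> R) (M : \bar R).

(** With index type ['I_m.+2] there is at least one rival, so the maximum is finite and [fine] loses
    nothing. *)
Definition omax Y : R := fine (\big[Order.max/-oo]_(j < m.+2 | j != i) (Y j)%:E)%E.

Lemma omaxE Y : (\big[Order.max/-oo]_(j < m.+2 | j != i) (Y j)%:E)%E = (omax Y)%:E.
Proof.
rewrite /omax fineK// fin_numE; apply/andP; split.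
  have [j ji] : exists j : 'I_m.+2, j != i.
    by exists (if i == ord0 then ord_max else ord0); case: ifPn => [/eqP ->|]; rewrite // eq_sym.
  by rewrite (bigD1 j)//= -ltNye lt_max ltNyr.
rewrite -ltey; elim/big_ind: _ => // [x y xl yl|j _]; last exact: ltry.
by rewrite gt_max xl.
Qed.

Lemma omax_le Y x : (omax Y <= x) = [forall j, (j != i) ==> (Y j <= x)].
Proof.
rewrite -lee_fin -omaxE; apply/idP/forallP => [h j|h].
  apply/implyP => ji; rewrite -lee_fin; apply: le_trans h.
  by rewrite (bigD1 j)//= le_max lexx.
elim/big_ind: _ => // [|a b ax bx|j ji]; first exact: leNye.
  by rewrite ge_max ax.
by have /implyP/(_ ji) := h j; rewrite lee_fin.
Qed.

Lemma mxE Y : (\big[Order.max/-oo]_(j < m.+2) (Y j)%:E)%E = (Num.max (Y i) (omax Y))%:E.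
Proof. by rewrite (bigD1 i)//= omaxE EFin_max. Qed.

(** Ties are counted by a sum of indicators and the equality with [M] is split into two
    inequalities, the form in which measurability is checked. *)
Lemma payoffE Y M : payoff K K2 i Y M =
  (omax Y <= Y i)%R%:R / (\sum_(l < m.+2) (Y l == Num.max (Y i) (omax Y))%:R)
  - K * ((Y i < omax Y)%R && ((omax Y)%:E < M)%E)%:R
  - K2 * ((Y i < omax Y)%R && ((omax Y)%:E <= M)%E && (M <= (omax Y)%:E)%E)%:R.
Proof.
rewrite /payoff mxE omaxE; congr (_ / _ - K * _ - K2 * _).
- congr (_%:R); rewrite eqe; have [|] := leP (omax Y) (Y i) => h.
    by rewrite eqxx.
  by rewrite lt_eqF.
- rewrite -sum1_card natr_sum big_mkcond /=; apply: eq_bigr => l _.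
  have -> : (l \in in_set [set l0 | (Y l0)%:E == (Num.max (Y i) (omax Y))%:E]) =
      (Y l == Num.max (Y i) (omax Y)).
    by rewrite unfold_in; apply/asboolP/idP; rewrite /= eqe.
  by case: ifP.
- by rewrite lte_fin -andbA eq_le.
Qed.

Hypotheses (K0 : 0 <= K) (K20 : 0 <= K2).

Let natb_itv (x : R) (b : bool) : 0 <= x -> 0 <= x * b%:R <= x.
Proof. by case: b => x0; rewrite ?mulr1 ?mulr0 ?x0 lexx. Qed.

(** When player [i] is not beaten, the prize is at most [1] and the extra [K] pays for the regret
    term; when beaten, the regret [K] is exact and only the nonnegative [K2] charge is dropped. *)
Lemma payoff_le Y M : ((Y i)%:E <= M)%E ->
  payoff K K2 i Y M <= (1 + K) * (omax Y <= Y i)%R%:R - K * ((omax Y)%:E < M)%E%:R.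
Proof.
move=> YM; rewrite payoffE; have [VY|YV] := leP (omax Y) (Y i).
  rewrite !mulr0 !subr0 mulr1 /=.
  have k1 : 1 <= \sum_(l < m.+2) (Y l == Y i)%:R :> R.
    rewrite (bigD1 i)//= eqxx lerDl; apply: sumr_ge0 => l _; exact: ler0n.
  have : 1 / (\sum_(l < m.+2) (Y l == Y i)%:R) <= 1 :> R.
    by rewrite ler_pdivrMr ?mul1r// (lt_le_trans ltr01).
  by move: (1 / _) (natb_itv ((omax Y)%:E < M)%E K0) => q /andP[_]; move: (K * _) => r; lra.
rewrite /= mul0r mulr0 !add0r gerBl.
by have /andP[] := natb_itv (((omax Y)%:E <= M)%E && (M <= (omax Y)%:E)%E) K20.
Qed.

(** Without ties a win pays [1], and [omax Y < Y i <= M] turns the right side into [(1 + K) - K]; a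
    loss carries no [K2] charge since the rivals' best differs from [M]. *)
Lemma payoff_eq Y M : ((Y i)%:E <= M)%E -> omax Y != Y i -> (omax Y)%:E != M ->
  payoff K K2 i Y M = (1 + K) * (omax Y <= Y i)%R%:R - K * ((omax Y)%:E < M)%E%:R.
Proof.
move=> YM VY VM; rewrite payoffE; have [YV|YV] := ltP (Y i) (omax Y).
  rewrite /= mul0r mulr0 !add0r -eq_le (negbTE VM) mulr0 subr0.
  by [].
have lVY : omax Y < Y i by rewrite lt_neqAle VY.
rewrite /= !mulr0 !subr0 !mulr1.
have -> : ((omax Y)%:E < M)%E by rewrite (lt_le_trans _ YM)// lte_fin.
rewrite (bigD1 i)//= eqxx big1 ?addr0 ?divr1; first by rewrite mulr1; lra.
move=> l li; apply/eqP; rewrite pnatr_eq0 eqb0 lt_eqF//.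
apply: le_lt_trans lVY; have := lexx (omax Y); rewrite omax_le => /forallP /(_ l).
by rewrite li.
Qed.

Lemma payoff_bound Y M : `|payoff K K2 i Y M| <= 1 + K + K2.
Proof.
rewrite payoffE.
have k0 : 0 <= \sum_(l < m.+2) (Y l == Num.max (Y i) (omax Y))%:R :> R.
  by apply: sumr_ge0 => l _; exact: ler0n.
set k := \sum_(l < _) _ in k0 *.
have a0 : 0 <= (omax Y <= Y i)%R%:R / k by rewrite divr_ge0.
have a1 : (omax Y <= Y i)%R%:R / k <= 1.
  have [VY|_] := leP (omax Y) (Y i); last by rewrite mul0r.
  have k1 : 1 <= k.
    rewrite /k (bigD1 i)//= max_l// eqxx lerDl; apply: sumr_ge0 => l _; exact: ler0n.
  by rewrite ler_pdivrMr ?mul1r// (lt_le_trans ltr01).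
move: a0 a1; move: (_ / k) => a a0 a1; rewrite ler_norml.
set b1 := (_ && (_ < M)%E); set b2 := (_ && _ && _).
have /andP[] := natb_itv b1 K0; have /andP[] := natb_itv b2 K20.
by move: (K * _) (K2 * _) => r1 r2 ? ? ? ?; apply/andP; split; lra.
Qed.

Lemma measurable_bool_natr d (T : measurableType d) (b : T -> bool) :
  measurable_fun setT b -> measurable_fun setT (fun w => (b w)%:R : R).
Proof.
move=> mb; rewrite (_ : (fun w => _) = (fun w => if b w then 1 else 0)).
  exact: measurable_fun_ifT.
by apply/funext => w; case: (b w).
Qed.

Lemma measurable_omax d (T : measurableType d) (Y : 'I_m.+2 -> T -> R) :
  (forall j, measurable_fun setT (Y j)) ->
  measurable_fun setT (fun w => omax (Y ^~ w)).
Proof.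
move=> mY _; apply: (measurability _ (RGenOInfty.measurableE R)) => //.
move=> _ [_ [x ->] <-]; rewrite setTI.
rewrite [X in measurable X](_ : _ = ~` \big[setI/setT]_(j < m.+2 | j != i) (Y j @^-1` `]-oo, x]%classic)).
  apply: measurableC; apply: bigsetI_measurable => j _.
  by rewrite -[X in measurable X]setTI; exact: mY.
apply/seteqP; split => w /=; rewrite in_itv/= andbT ltNge omax_le.
  move=> /negP h hb; apply: h; apply/forallP => j; apply/implyP => ji.
  by move: hb; rewrite (bigD1 j)//= => -[]; rewrite /= in_itv.
move=> h; apply/negP => /forallP hb; apply: h.
elim/big_ind: _ => // j ji /=; rewrite in_itv/=.
by have /implyP/(_ ji) := hb j.
Qed.

Lemma measurable_payoff d (T : measurableType d) (Y : 'I_m.+2 -> T -> R) (M : T -> \bar R) :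
  (forall j, measurable_fun setT (Y j)) -> measurable_fun setT M ->
  measurable_fun setT (fun w => payoff K K2 i (Y ^~ w) (M w)).
Proof.
move=> mY mM.
have mV := measurable_omax mY.
have mVE : measurable_fun setT (fun w => (omax (Y ^~ w))%:E) by exact/measurable_EFinP.
(* The reciprocal of the nonnegative count is rewritten as its power [-1], to which the
   measurability of [powR] applies. *)
rewrite (_ : (fun w => _) = fun w => (omax (Y ^~ w) <= Y i w)%R%:R *
    powR (\sum_(l < m.+2) (Y l w == Num.max (Y i w) (omax (Y ^~ w)))%:R) (-1)
  - K * ((Y i w < omax (Y ^~ w))%R && ((omax (Y ^~ w))%:E < M w)%E)%:R
  - K2 * ((Y i w < omax (Y ^~ w))%R && ((omax (Y ^~ w))%:E <= M w)%E &&
    (M w <= (omax (Y ^~ w))%:E)%E)%:R); last first.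
  apply/funext => w; rewrite payoffE powR_inv1//.
  by apply: sumr_ge0 => l _; exact: ler0n.
apply: measurable_funB; [apply: measurable_funB|].
- apply: measurable_funM.
    by apply: measurable_bool_natr; exact: measurable_fun_ler.
  apply: (@measurableT_comp _ _ _ _ _ _ (fun x : R => powR x (-1)) _ _ (measurable_powR (-1))).
  rewrite (_ : (fun w => _) = \sum_(l < m.+2)
    (fun w => (Y l w == Num.max (Y i w) (omax (Y ^~ w)))%:R)); last first.
    by apply/funext => w; rewrite fct_sumE.
  elim/big_ind: _ => [|f g mf mg|l _]; first exact: measurable_cst.
    exact: measurable_funD.
  apply: measurable_bool_natr; apply: measurable_fun_eqr => //.
  exact: measurable_maxr.
- apply: measurable_funM => //; apply: measurable_bool_natr.
  by apply: measurable_and; [exact: measurable_fun_ltr|exact: measurable_fun_lte].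
- apply: measurable_funM => //; apply: measurable_bool_natr.
  apply: measurable_and; [apply: measurable_and|exact: measurable_fun_lee].
    exact: measurable_fun_ltr.
  exact: measurable_fun_lee.
Qed.

End Payoff.

(** * Independence from the rivals' best value and comparison of payoffs *)

Section Equilibrium.
Context {R : realType} {d : measure_display} {Omega : measurableType d}.
Variables (P : probability Omega R) (m : nat) (x0 K K2 : R).
Local Notation n := m.+2.
Local Notation F := (Flaw n x0).
Variables (X W : 'I_n -> R -> Omega -> R).
Hypotheses (x00 : 0 < x0) (K0 : 0 <= K) (K20 : 0 <= K2).
Hypothesis hW : forall i, standard_BM P (W i).
Hypothesis hX : forall i (t : R) w, 0 <= t ->
  X i t w = if (t%:E <= hit0 (fun s w => (x0 + W i s w)%R) w)%E then x0 + W i t w else 0.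
Hypothesis ind : mutually_independent P (fun i => gen_by (X i) [set t | 0 <= t]).
Variable tau : 'I_n -> Omega -> \bar R.
Hypothesis adm : forall j, admissible (X j) (tau j).
Hypothesis law : forall j, has_law P (X j) (tau j) F.

Let c := n%:R * x0.
Let c0 : 0 < c. Proof. by rewrite mulr_gt0. Qed.
Let Gi i := gen_by (X i) [set t | 0 <= t].
Let Y j := stopped (X j) (tau j).
Let V i w := omax i (Y ^~ w).
Let G x := F x ^+ m.+1.

Let Xc i w : {within [set t : R | 0 <= t], continuous (X i ^~ w)}.
Proof. exact: (X_cts (hW i) x00 (hX i)). Qed.

Let GiM i : Gi i `<=` measurable.
Proof. exact: (gen_by_X_measurable (hW i) x00 (hX i)). Qed.

Let mG i (f : Omega -> R) : (forall C, measurable C -> Gi i (f @^-1` C)) ->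
  measurable_fun setT f.
Proof. by move=> h _ C mC; rewrite setTI; apply: (@GiM i); exact: h. Qed.

Let GiY i C : measurable C -> Gi i (Y i @^-1` C).
Proof. by move=> mC; apply: stopped_gen => //; exact: Xc. Qed.

Let mY i : measurable_fun setT (Y i). Proof. by apply: (@mG i); exact: GiY. Qed.

Let mV i : measurable_fun setT (V i).
Proof. exact: measurable_omax. Qed.

Let G_ge0 x : 0 <= G x. Proof. by rewrite exprn_ge0// Flaw_ge0. Qed.

(** The distribution function of [V i] is Lipschitz with constant [1 / c], which excludes atoms. *)
Let G_lip (x e : R) : 0 <= e -> G x - G (x - e) <= e / c.
Proof.
move=> e0; have ec : 0 <= e / c by rewrite divr_ge0// ltW.
have [xx0|xx0] := ltP x 0.
  have Fn y : y < 0 -> G y = 0 by move=> y0; rewrite /G /Flaw y0 expr0n.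
  by rewrite !Fn ?subrr//; lra.
rewrite {1}/G Flaw_exp// -/c.
have [xe|xe] := ltP (x - e) 0.
  rewrite {1}/G /Flaw xe expr0n /= subr0 ge_min; apply/orP; left.
  by rewrite ler_pM2r ?invr_gt0//; lra.
rewrite /G Flaw_exp// -/c mulrBl.
have [|] := leP (x / c) 1; have [|] := leP (x / c - e / c) 1; lra.
Qed.

Let G_le (x : R) : 0 <= x -> G x <= x / c.
Proof. by move=> xx0; rewrite /G Flaw_exp// ge_min lexx. Qed.

Let measurable_G : measurable_fun setT G.
Proof. by apply: measurable_funX; exact: measurable_Flaw. Qed.

Let VleE i (x : R) : [set w | V i w <= x] = V i @^-1` `]-oo, x]%classic.
Proof. by apply/seteqP; split => w /=; rewrite in_itv. Qed.

Let mVle i (x : R) : measurable [set w | V i w <= x].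
Proof. by rewrite VleE -[X in measurable X]setTI; exact: mV. Qed.

(** An event of player [i] and the events [Y j <= x] of the rivals form one family, one event per
    player, to which mutual independence applies; the rivals contribute [F x ^+ m.+1]. *)
Let ind_ray i A (x : R) : Gi i A ->
  P (A `&` [set w | V i w <= x]) = (P A * (G x)%:E)%E.
Proof.
move=> GA; pose A' j := if j == i then A else [set w | Y j w <= x].
have GA' j : gen_by (X j) [set t | 0 <= t] (A' j).
  rewrite /A'; case: eqVneq => [->//|_].
  rewrite (_ : [set w | _] = Y j @^-1` `]-oo, x]%classic); first exact: GiY.
  by apply/seteqP; split => w /=; rewrite in_itv.
rewrite (_ : A `&` _ = \bigcap_(j in [set: 'I_n]) A' j); last first.
  apply/seteqP; split => w.
    move=> [Aw /=]; rewrite omax_le => /forallP h j _; rewrite /A'.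
    by case: ifPn => // ji; have /implyP/(_ ji) := h j.
  move=> h; split; first by have := h i I; rewrite /A' eqxx.
  rewrite /= omax_le; apply/forallP => j; apply/implyP => ji.
  by have := h j I; rewrite /A' (negbTE ji).
rewrite ind// (bigD1 i)//= /A' eqxx; congr (_ * _)%E.
rewrite (eq_bigr (fun=> (F x)%:E)); last first.
  by move=> j ji; rewrite (negbTE ji); exact: law.
by rewrite prodEFin prodr_const cardC1 card_ord.
Qed.

Let GiT i : Gi i setT.
Proof. exact: (@measurableT _ (g_sigma_algebraType _)). Qed.

Let PV_le i (x : R) : P [set w | V i w <= x] = (G x)%:E.
Proof. by have := ind_ray x (@GiT i); rewrite setTI probability_setT mul1e. Qed.

(** The sets [V i <= x], with the full set added, form a pi-system generating the sigma-algebra of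
    [V i]. *)
Let indV i A E : Gi i A -> measurable E ->
  P (A `&` V i @^-1` E) = (P A * P (V i @^-1` E))%E.
Proof.
move=> GA mE; have mA := GiM GA.
pose S := [set B | B = setT \/ exists x : R, B = [set w | V i w <= x]].
rewrite setIC muleC; apply: (@indep_setI_closed _ _ _ P S A) => //.
- by move=> B [->//|[x ->]]; exact: mVle.
- move=> B1 B2 [->|[x ->]] [->|[y ->]]; rewrite ?setTI ?setIT; [by left|..].
  + by right; exists y.
  + by right; exists x.
  + right; exists (Num.min x y); apply/seteqP; split => w /=; rewrite le_min.
      by move=> [-> ->].
    by move=> /andP[].
- by left.
- move=> B [->|[x ->]]; first by rewrite setTI probability_setT mul1e.
  by rewrite setIC ind_ray// PV_le muleC.
- have mVS : measurable_fun [set: g_sigma_algebraType S] (V i : g_sigma_algebraType S -> R).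
    move=> _; apply: (measurability _ (RGenOInfty.measurableE R)) => //.
    move=> _ [_ [x ->] <-]; rewrite setTI.
    rewrite [X in measurable X](_ : _ = ~` [set w | V i w <= x]).
      by apply: measurableC; apply: sub_sigma_algebra; right; exists x.
    by apply/seteqP; split => w /=; rewrite in_itv/= andbT ltNge => /negP.
  by have := mVS measurableT E mE; rewrite setTI.
Qed.

Let integral_bool (b : Omega -> bool) : measurable [set w | b w] ->
  (\int[P]_w ((b w)%:R)%:E = P [set w | b w])%E.
Proof.
move=> mb; transitivity (\int[P]_w (\1_[set w | b w] w)%:E)%E; last first.
  by rewrite integral_indic// setIT.
apply: eq_integral => w _; congr (_%:E); rewrite indicE; congr (nat_of_bool _)%:R.
by apply/idP/idP => [bw|/set_mem//]; exact/mem_set.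
Qed.

Section Against.
Variables (i : 'I_n) (Z : Omega -> R).
Hypothesis GZ : forall C, measurable C -> Gi i (Z @^-1` C).

Let mZ : measurable_fun setT Z. Proof. exact: (@mG i). Qed.

Let mVm := isMeasurableFun.Build _ _ _ _ _ (mV i).
Let V' : {mfun Omega >-> R} := HB.pack (V i) mVm.
Let nu : probability R R := distribution P V'.

Let fubiniV (b : R -> R -> bool) :
  measurable_fun [set: R * R] (fun x : R * R => b x.1 x.2) ->
  (\int[P]_w ((b (Z w) (V i w))%:R)%:E = \int[P]_w \int[nu]_v ((b (Z w) v)%:R)%:E)%E.
Proof.
move=> mb.
have mf : measurable_fun [set: R * R] (fun x : R * R => ((b x.1 x.2)%:R)%:E : \bar R).
  by apply/measurable_EFinP; exact: measurable_bool_natr.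
apply: (@integral_indep R _ _ _ Omega R R P setT Z (V i) nu
  (fun x : R * R => ((b x.1 x.2)%:R)%:E) measurableT mZ (mV i) _ mf).
  move=> C E mC mE; rewrite setTI; apply: indV => //; exact: GZ.
by move=> x; rewrite lee_fin ler0n.
Qed.

Lemma prob_V_le : P [set w | V i w <= Z w] = (\int[P]_w (G (Z w))%:E)%E.
Proof.
have mb : measurable_fun [set: R * R] (fun x : R * R => x.2 <= x.1).
  by apply: measurable_fun_ler; [exact: measurable_snd|exact: measurable_fst].
have mE : measurable [set w | V i w <= Z w].
  have := measurable_fun_ler (mV i) mZ measurableT (Y := [set true]).
  rewrite setTI; apply => //.
rewrite -(integral_bool mE) (fubiniV (b := fun u v => v <= u) mb); apply: eq_integral => w _.
rewrite -(PV_le i).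
transitivity (\int[nu]_v (\1_(`]-oo, (Z w)]%classic) v)%:E)%E.
  apply: eq_integral => v _; congr (_%:E); rewrite indicE; congr (nat_of_bool _)%:R.
  by apply/idP/idP => [h|/set_mem]; [apply/mem_set|]; rewrite /= in_itv.
rewrite integral_indic// setIT /nu /distribution /pushforward /=.
by rewrite VleE.
Qed.

(** Applied to [Y i] it removes ties; applied to the maximum of the path it removes the case charged
    with [K2]. *)
Lemma prob_V_eq : P [set w | V i w == Z w] = 0%E.
Proof.
have mb : measurable_fun [set: R * R] (fun x : R * R => x.2 == x.1).
  by apply: measurable_fun_eqr; [exact: measurable_snd|exact: measurable_fst].
have mE : measurable [set w | V i w == Z w].
  have := measurable_fun_eqr (mV i) mZ measurableT (Y := [set true]).
  rewrite setTI; apply => //.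
rewrite -(integral_bool mE) (fubiniV (b := fun u v => v == u) mb); apply: integral0_eq => w _.
transitivity (\int[nu]_v (\1_([set (Z w)]) v)%:E)%E.
  apply: eq_integral => v _; congr (_%:E); rewrite indicE; congr (nat_of_bool _)%:R.
  by apply/idP/idP => [/eqP ->|/set_mem /= ->//]; exact/mem_set.
rewrite integral_indic// setIT /nu /distribution /pushforward /=.
set z := Z w; have mz : measurable (V i @^-1` [set z]).
  by rewrite -[X in measurable X]setTI; apply: mV.
apply/eqP; rewrite eq_le measure_ge0 andbT.
apply/lee_addgt0Pr => e e0; rewrite add0e.
have ce0 : 0 <= c * e by rewrite mulr_ge0// ltW.
(* An interval of length [c * e] ending at [z] carries mass at most [e] by [G_lip], which bounds the
   atom at [z]. *)
apply: (@le_trans _ _ (P ([set w | V i w <= z] `\` [set w | V i w <= z - c * e]))).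
  rewrite -[X in (X <= _)%E]/(P (V i @^-1` [set z])).
  apply: le_measure; rewrite ?inE//; first by apply: measurableD; exact: mVle.
  move=> w' /= ->; split => //; apply/negP; rewrite -ltNge.
  by rewrite gtrBl mulr_gt0.
rewrite measureD//; last first.
  by rewrite -ge0_fin_numE ?fin_num_measure ?measure_ge0.
rewrite setIidr; last first.
  by move=> w' /= /le_trans; apply; rewrite gerBl.
apply: (@le_trans _ _ ((G z)%:E - (G (z - c * e))%:E)%E).
  by rewrite -!(PV_le i); exact: lexx.
rewrite -EFinB lee_fin (le_trans (G_lip _ ce0))//.
by rewrite mulrAC divff ?gt_eqF// mul1r.
Qed.

End Against.

Let bounded_integrable (f : Omega -> R) (b : R) : measurable_fun setT f ->
  (forall w, `|f w| <= b) -> P.-integrable setT (EFin \o f).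
Proof.
move=> mf fb; apply: (@le_integrable _ _ _ P setT measurableT _ (cst b%:E)).
- exact/measurable_EFinP.
- by move=> w _ /=; rewrite lee_fin (le_trans (fb w))// ler_norm.
- exact: finite_measure_integrable_cst.
Qed.

Let K1 : 0 <= 1 + K. Proof. by rewrite addr_ge0. Qed.

Let natb_bound (b : bool) : `|b%:R : R| <= 1.
Proof. by case: b; rewrite ?normr1 ?normr0. Qed.

Let GiS i sigma : admissible (X i) sigma ->
  forall C, measurable C -> Gi i (stopped (X i) sigma @^-1` C).
Proof. by move=> h C mC; apply: stopped_gen => //; exact: Xc. Qed.

Let Yge0 i sigma w : admissible (X i) sigma -> 0 <= stopped (X i) sigma w.
Proof. by move=> [h _]; apply: (stopped_ge0 (hW i) x00 (hX i)); have [] := h w. Qed.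

Let M i := run_max (X i).

Let hit0_ge0 i w : (0 <= hit0 (X i) w)%E.
Proof. by rewrite (X_hit0 (hW i) x00 (hX i)) first_hit_ge0. Qed.

Let GiMx i C : measurable C -> Gi i (M i @^-1` C).
Proof.
move=> mC; apply: run_max_gen => //.
- by move=> t w; exact: (X_ge0 (hW i) x00 (hX i)).
- by move=> t w; exact: (X_after (hW i) x00 (hX i)).
Qed.

Let mM i : measurable_fun setT (M i).
Proof. by move=> _ C mC; rewrite setTI; apply: (@GiM i); exact: GiMx. Qed.

Let stopped_le_M i sigma w : admissible (X i) sigma ->
  ((stopped (X i) sigma w)%:E <= M i w)%E.
Proof. by move=> [h _]; have [h0 h1] := h w; exact: stopped_le_run_max. Qed.

Let integral_G_law i j : (\int[P]_w (G (Y i w))%:E = \int[P]_w (G (Y j w))%:E)%E.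
Proof.
pose Yi : {RV P >-> R} := HB.pack (Y i) (isMeasurableFun.Build _ _ _ _ _ (mY i)).
pose Yj : {RV P >-> R} := HB.pack (Y j) (isMeasurableFun.Build _ _ _ _ _ (mY j)).
have mGE : measurable_fun setT (fun x => (G x)%:E) by exact/measurable_EFinP.
have GE0 x : (0 <= (G x)%:E)%E by rewrite lee_fin.
rewrite -[LHS](ge0_integral_distribution Yi mGE GE0).
rewrite -[RHS](ge0_integral_distribution Yj mGE GE0).
apply: eq_measure_integral => A mA _.
apply: measure_unique_rays => // x.
have E k : Y k @^-1` `]-oo, x]%classic = [set w | stopped (X k) (tau k) w <= x].
  by apply/seteqP; split => w /=; rewrite in_itv.
rewrite -[LHS]/(P (Y i @^-1` `]-oo, x]%classic)) -[RHS]/(P (Y j @^-1` `]-oo, x]%classic)).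
by rewrite !E !law.
Qed.

Lemma win_prob_le i sigma : admissible (X i) sigma ->
  (P [set w | (V i w <= stopped (X i) sigma w)%R] <= (n%:R^-1)%:E)%E.
Proof.
move=> ad; rewrite (prob_V_le (GiS ad)).
have mZ := @mG i _ (GiS ad).
apply: (@le_trans _ _ (\int[P]_w ((c^-1)%:E * (stopped (X i) sigma w)%:E))%E).
  apply: ge0_le_integral => //.
  - by move=> w _; rewrite lee_fin.
  - by apply/measurable_EFinP; exact: (measurableT_comp measurable_G mZ).
  - by apply: measurable_funeM; exact/measurable_EFinP.
  - by move=> w _; rewrite -EFinM lee_fin mulrC G_le//; exact: Yge0.
rewrite ge0_integralZl//; first last.
- by rewrite lee_fin invr_ge0 ltW.
- by move=> w _; rewrite lee_fin; exact: Yge0.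
- exact/measurable_EFinP.
apply: (@le_trans _ _ ((c^-1)%:E * x0%:E)%E).
  apply: lee_wpmul2l; first by rewrite lee_fin invr_ge0 ltW.
  exact: (integral_stopped_le (hW i) x00 (hX i)).
by rewrite -EFinM lee_fin /c invfM -mulrA mulVf ?mulr1// gt_eqF.
Qed.

Let mVleY i : measurable [set w | V i w <= Y i w].
Proof.
have := measurable_fun_ler (mV i) (mY i) measurableT (Y := [set true]).
by rewrite setTI; apply.
Qed.

(** Whoever holds the largest value satisfies [V j <= Y j], so these [n] indicators sum to at least
    [1]; their means are equal because [prob_V_le] makes each depend on the common law only. *)
Lemma win_prob_ge i : ((n%:R^-1)%:E <= P [set w | (V i w <= Y i w)%R])%E.
Proof.
pose f j w : \bar R := ((V j w <= Y j w)%R%:R)%:E.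
have If j : (\int[P]_w f j w = P [set w | (V i w <= Y i w)%R])%E.
  rewrite (integral_bool (mVleY j)) !prob_V_le ?(integral_G_law i j)//.
  - by move=> C mC; exact: GiY.
  - by move=> C mC; exact: GiY.
have mf j : measurable_fun setT (f j).
  apply/measurable_EFinP; apply: measurable_bool_natr.
  exact: measurable_fun_ler.
have h : (1%:E <= \int[P]_w \sum_(j < n) f j w)%E.
  rewrite -(integral_prob_cst P 1); apply: ge0_le_integral => //.
  - exact: emeasurable_sum.
  move=> w _; have [j _ hj] := @arg_maxP _ _ _ (@ord0 m.+1) xpredT (Y ^~ w) isT.
  rewrite (bigD1 j)//= /f (_ : (V j w <= Y j w) = true); last first.
    by rewrite omax_le; apply/forallP => l; apply/implyP => _; exact: hj.
  by rewrite leeDl//; apply: sume_ge0 => l _; rewrite lee_fin ler0n.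
move: h; rewrite ge0_integral_sum//; last first.
  by move=> j w _; rewrite lee_fin ler0n.
rewrite (eq_bigr (fun=> P [set w | V i w <= Y i w])); last by move=> j _; exact: If.
have /fineK <- : P [set w | V i w <= Y i w] \is a fin_num by exact: fin_num_measure.
rewrite sumEFin sumr_const card_ord !lee_fin => h.
by rewrite -[_^-1]mul1r ler_pdivrMr// mulr_natr.
Qed.

(** The bound of [payoff_le]: [Z] enters only through the event of not being beaten, so the term
    with [q i] is the same for all strategies of player [i]. *)
Let lin i (Z : Omega -> R) w : R :=
  (1 + K) * (V i w <= Z w)%R%:R - K * ((V i w)%:E < M i w)%E%:R.
Let q i := fine (P [set w | ((V i w)%:E < M i w)%E]).

Let mlin i (Z : Omega -> R) : measurable_fun setT Z -> measurable_fun setT (lin i Z).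
Proof.
move=> mZ; apply: measurable_funB; apply: measurable_funM => //;
  apply: measurable_bool_natr.
- exact: measurable_fun_ler.
- by apply: measurable_fun_lte => //; apply/measurable_EFinP.
Qed.

Let ilin i (Z : Omega -> R) : measurable_fun setT Z ->
  P.-integrable setT (EFin \o lin i Z).
Proof.
move=> mZ; apply: (@bounded_integrable _ (1 + K + K)); first exact: mlin.
move=> w; rewrite /lin (le_trans (ler_normB _ _))// !normrM.
rewrite (ger0_norm K1) (ger0_norm K0).
by apply: lerD; apply: ler_piMr.
Qed.

Let integral_lin i (Z : Omega -> R) : measurable_fun setT Z ->
  (\int[P]_w (lin i Z w)%:E =
   ((1 + K) * fine (P [set w | V i w <= Z w]) - K * q i)%:E)%E.
Proof.
move=> mZ.
have mb1 : measurable_fun setT (fun w => V i w <= Z w) by exact: measurable_fun_ler.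
have mb2 : measurable_fun setT (fun w => ((V i w)%:E < M i w)%E).
  by apply: measurable_fun_lte => //; apply/measurable_EFinP.
have ms1 : measurable [set w | V i w <= Z w].
  by have := mb1 measurableT [set true]; rewrite setTI; apply.
have ms2 : measurable [set w | ((V i w)%:E < M i w)%E].
  by have := mb2 measurableT [set true]; rewrite setTI; apply.
have i1 : P.-integrable setT (EFin \o (fun w => (V i w <= Z w)%R%:R : R)).
  by apply: (@bounded_integrable _ 1) => //; exact: measurable_bool_natr.
have i2 : P.-integrable setT (EFin \o (fun w => ((V i w)%:E < M i w)%E%:R : R)).
  by apply: (@bounded_integrable _ 1) => //; exact: measurable_bool_natr.
transitivity (\int[P]_w ((1 + K)%:E * ((V i w <= Z w)%R%:R)%:E
   - K%:E * (((V i w)%:E < M i w)%E%:R)%:E))%E.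
  by apply: eq_integral => w _; rewrite /lin EFinB !EFinM.
rewrite integralB//; [|exact: integrableZl|exact: integrableZl].
rewrite integralZl// integralZl// !integral_bool//.
by rewrite EFinB !EFinM /q !fineK// fin_num_measure.
Qed.

Let Yupd sigma i w j :
  stopped (X j) (upd tau i sigma j) w = if j == i then stopped (X i) sigma w else Y j w.
Proof. by rewrite /upd; case: eqVneq => [->|]. Qed.

Lemma exp_payoff_le i sigma : admissible (X i) sigma ->
  (exp_payoff P K K2 X (upd tau i sigma) i <=
   ((1 + K) * n%:R^-1 - K * q i)%:E)%E.
Proof.
move=> ad; have mZ := @mG i _ (GiS ad).
apply: (@le_trans _ _ (\int[P]_w (lin i (stopped (X i) sigma) w)%:E)%E).
  have mU j : measurable_fun setT (stopped (X j) (upd tau i sigma j)).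
    by rewrite /upd; case: eqVneq => [->//|_]; exact: mY.
  apply: le_integral => //; last 2 first.
  - exact: ilin.
  - move=> w _; rewrite lee_fin.
    have := @payoff_le _ _ K K2 i K0 K20
      (fun j => stopped (X j) (upd tau i sigma j) w) (M i w).
    have -> : omax i (fun j => stopped (X j) (upd tau i sigma j) w) = V i w.
      rewrite /V /omax; congr fine; apply: eq_bigr => j ji.
      by rewrite Yupd (negbTE ji).
    by rewrite Yupd eqxx; apply; exact: stopped_le_M.
  - apply: (@bounded_integrable _ (1 + K + K2)) => [|w]; last exact: payoff_bound.
    exact: (measurable_payoff K K2 i mU (mM i)).
rewrite integral_lin// lee_fin lerD2r ler_wpM2l//.
rewrite -lee_fin fineK; first exact: win_prob_le.
apply: fin_num_measure.
by have := measurable_fun_ler (mV i) mZ measurableT (Y := [set true]); rewrite setTI; apply.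
Qed.

Lemma exp_payoff_ge i :
  (((1 + K) * n%:R^-1 - K * q i)%:E <= exp_payoff P K K2 X tau i)%E.
Proof.
apply: (@le_trans _ _ (\int[P]_w (lin i (Y i) w)%:E)%E).
  rewrite integral_lin// lee_fin lerD2r ler_wpM2l//.
  by rewrite -lee_fin fineK; [exact: win_prob_ge|exact: fin_num_measure].
rewrite /exp_payoff le_eqVlt; apply/orP; left; apply/eqP.
apply: ae_eq_integral => //.
- by apply/measurable_EFinP; exact: mlin.
- by apply/measurable_EFinP; exact: (measurable_payoff K K2 i mY (mM i)).
(* [prob_V_eq] takes a real-valued variable, while [M i] is extended-real; as [V i] is real,
   equality with [M i] implies equality with [fine (M i)]. *)
have GfM C : measurable C -> Gi i ((fine \o M i) @^-1` C).
  move=> mC; rewrite comp_preimage; apply: GiMx.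
  by have := fine_measurable measurableT measurableT mC; rewrite setTI.
have mfM := @mG i _ GfM.
have mE1 : measurable [set w | V i w == Y i w].
  by have := measurable_fun_eqr (mV i) (mY i) measurableT (Y := [set true]);
     rewrite setTI; apply.
have mE2 : measurable [set w | V i w == (fine \o M i) w].
  by have := measurable_fun_eqr (mV i) mfM measurableT (Y := [set true]);
     rewrite setTI; apply.
exists ([set w | V i w == Y i w] `|` [set w | V i w == (fine \o M i) w]); split.
- exact: measurableU.
- apply/eqP; rewrite eq_le measure_ge0 andbT.
  apply: (le_trans (measureU2 _ _ _)) => //.
  apply: (@le_trans _ _ (0 + 0)%E); last by rewrite adde0.
  by apply: leeD; rewrite le_eqVlt; apply/orP; left; apply/eqP;
     [exact: (prob_V_eq (@GiY i))|exact: (prob_V_eq GfM)].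
- move=> w /= /not_implyP[_]; apply: contra_notP => /not_orP[/negP h1 /negP h2].
  congr (_%:E); apply/esym/payoff_eq => //; first exact: stopped_le_M.
  by apply: contra h2; rewrite /M => /eqP <-.
Qed.

End Equilibrium.
Theorem theorem6 (R : realType) (d : measure_display) (Omega : measurableType d)
  (P : probability Omega R) (n : nat) (x0 K K2 : R)
  (X : 'I_n -> R -> Omega -> R) :
  (2 <= n)%N -> 0 < x0 -> 0 <= K -> 0 <= K2 -> K2 <= K ->
  (forall i, absorbed_BM P x0 (X i)) ->
  mutually_independent P (fun i => gen_by (X i) [set t | 0 <= t]) ->
  (exists tau : 'I_n -> Omega -> \bar R,
     forall i, admissible (X i) (tau i) /\ has_law P (X i) (tau i) (Flaw n x0))
  /\
  (forall (tau : 'I_n -> Omega -> \bar R),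
     (forall j, admissible (X j) (tau j) /\ has_law P (X j) (tau j) (Flaw n x0)) ->
     forall (i : 'I_n) (sigma : Omega -> \bar R), admissible (X i) sigma ->
       (exp_payoff P K K2 X (upd tau i sigma) i <= exp_payoff P K K2 X tau i)%E).

Proof.
case: n X => [|[|m]]// X _ x00 K0 K20 _ /choice[W hWX] ind.
have hW i := (hWX i).1.
have hX i t w := (hWX i).2 t w.
split.
  exists (fun i => AY_time (X i) x0 m) => i; split.
    exact: (AY_admissible m (hW i) x00 (hX i)).
  exact: (AY_law m (hW i) x00 (hX i)).
move=> tau ht i sigma ad.
have adm j := (ht j).1; have law j := (ht j).2.
apply: (le_trans (exp_payoff_le x00 K0 K20 hW hX ind adm law ad)).
exact: (exp_payoff_ge K2 x00 K0 hW hX ind adm law).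
Qed.
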